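(* Let $d\geq1$ be an integer, let $\beta=\frac d2+1$, let $\alpha$ be fixed with $\frac d2<\alpha<\beta$, and let $b>0$. As $a$ and $\gamma$ tend to infinity in such a way that $\frac a{\sqrt\gamma}$ tends to $b$, the Gauss hypergeometric covariance $G_d(\cdot;a,\alpha,\beta,\gamma)$ converges uniformly on $\mathbb{R}^d$ to the covariance kernel $$\boldsymbol h\mapsto Q\left(\alpha-\frac d2,\frac{\|\boldsymbol h\|^2}{b^2}\right),\qquad\boldsymbol h\in\mathbb{R}^d,$$ where $Q$ is the regularized (upper) incomplete gamma function. The same result holds by interchanging $\beta$ and $\gamma$.
   Context: For $a>0$, $\alpha>\frac d2$, $\beta>\alpha$, $\gamma>\alpha$, the Gauss hypergeometric covariance is $$G_d(\boldsymbol h;a,\alpha,\beta,\gamma)=\frac{\Gamma(\beta-\frac d2)\Gamma(\gamma-\frac d2)}{\Gamma(\beta-\alpha+\gamma-\frac d2)\Gamma(\alpha-\frac d2)}\left(1-\frac{\|\boldsymbol h\|^2}{a^2}\right)_+^{\beta-\alpha+\gamma-\frac d2-1}{}_2F_1\left(\beta-\alpha,\gamma-\alpha;\beta-\alpha+\gamma-\tfrac d2;\left(1-\tfrac{\|\boldsymbol h\|^2}{a^2}\right)_+\right),\quad\boldsymbol h\in\mathbb{R}^d,$$ where $(x)_+=\max\{x,0\}$ and ${}_2F_1$ is the Gauss hypergeometric function. $Q(s,x)=\frac{1}{\Gamma(s)}\int_x^{+\infty}t^{s-1}e^{-t}\,dt$ for $s>0$, $x\geq0$. ''Covariance kernel''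 in $\mathbb{R}^d$ means positive semidefinite function $\boldsymbol h\mapsto C(\boldsymbol h)$. *)

(* Defs.v *)
From HB Require Import structures.
From mathcomp Require Import all_boot all_order all_algebra.
From mathcomp Require Import all_classical all_reals all_analysis.

Set Implicit Arguments.
Unset Strict Implicit.
Unset Printing Implicit Defensive.

Import Order.TTheory GRing.Theory Num.Theory.
Import numFieldNormedType.Exports.

Local Open Scope classical_set_scope.
Local Open Scope ring_scope.

(* The norm that the library puts on row vectors is the sup norm, hence this
   explicit Euclidean norm. *)
Definition eucl_norm (R : realType) (d : nat) (h : 'rV[R]_d) : R :=
  Num.sqrt (\sum_(i < d) h ord0 i ^+ 2).

Definition posp (R : realType) (x : R) : R := Num.max x 0.

(* Euler's integral, meaningful for 0 < s; the integrand's value at the single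
   point t = 0 is a convention of powR and does not affect the integral. *)
Definition Gamma (R : realType) (s : R) : R :=
  \int[@lebesgue_measure R]_(t in `[0, +oo[) (t `^ (s - 1) * expR (- t)).

(* Regularized upper incomplete gamma function. *)
Definition Qgamma (R : realType) (s x : R) : R :=
  (Gamma s)^-1 *
  \int[@lebesgue_measure R]_(t in `[x, +oo[) (t `^ (s - 1) * expR (- t)).

(* Rising factorial x (x + 1) ... (x + n - 1). *)
Definition pochhammer (R : realType) (x : R) (n : nat) : R :=
  \prod_(k < n) (x + k%:R).

(* Gauss series; it converges for |z| < 1, and also at z = 1 if p + q < r. *)
Definition hyp2F1 (R : realType) (p q r z : R) : R :=
  limn (series (fun n : nat =>
    pochhammer p n * pochhammer q n / pochhammer r n * (z ^+ n / n`!%:R))).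

Definition gauss_hyp_cov (R : realType) (d : nat) (a alpha beta gamma : R)
    (h : 'rV[R]_d) : R :=
  let u := posp (1 - eucl_norm h ^+ 2 / a ^+ 2) in
  Gamma (beta - d%:R / 2) * Gamma (gamma - d%:R / 2) /
    (Gamma (beta - alpha + gamma - d%:R / 2) * Gamma (alpha - d%:R / 2)) *
  u `^ (beta - alpha + gamma - d%:R / 2 - 1) *
  hyp2F1 (beta - alpha) (gamma - alpha) (beta - alpha + gamma - d%:R / 2) u.

(* Evenness is required separately because, unlike with complex weights, it does
   not follow from nonnegativity of the quadratic forms with real weights. *)
Definition covariance_kernel (R : realType) (d : nat) (C : 'rV[R]_d -> R) : Prop :=
  (forall h, C (- h) = C h) /\
  (forall (n : nat) (x : 'I_n -> 'rV[R]_d) (w : 'I_n -> R),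
     0 <= \sum_(i < n) \sum_(j < n) w i * w j * C (x i - x j)).

(* Main.v *)
(* Put s := alpha - d/2, which lies in (0, 1), and c := gamma - alpha.  Since
   beta - d/2 = 1, the ratio (c)_n / (c + 1)_n in the Gauss series is c / (c + n),
   so that integrating the binomial series of (t/c)^(s-1) around t = c termwise
   gives
     G_d(h) = kappa_c / Gamma(s) * \int_x^c t^(s-1) (1 - t/c)^(c-1) dt,
     x = c |h|^2 / a^2,  kappa_c = Gamma(c + s) c^(1-s) / Gamma(c + 1).
   Wendel's inequality gives kappa_c -> 1, the integrand differs from
   t^(s-1) e^(-t) by at most (64/c) e^(-t/4), and t^(s-1) e^(-t) <= 1/t controls the
   replacement of x by |h|^2 / b^2.  All three errors are independent of h.

   For positive semidefiniteness,
     Gamma(s, x) = \int_0^oo (t + x)^(s-1) e^(-(t + x)) dt,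
   and A^(s-1) is a mixture of the exponentials e^(-vA), so that Gamma(s, |h|^2/b^2)
   is a mixture of Gaussian kernels. *)

Require Import Defs.
From HB Require Import structures.
From mathcomp Require Import all_boot all_order all_algebra.
From mathcomp Require Import all_classical all_reals all_analysis.
From mathcomp Require Import measurable_realfun ring lra.

Set Implicit Arguments.
Unset Strict Implicit.
Unset Printing Implicit Defensive.

Import Order.TTheory GRing.Theory Num.Theory.
Import numFieldNormedType.Exports.

Local Open Scope classical_set_scope.
Local Open Scope ring_scope.

Local Notation mu := lebesgue_measure.

(** * The Gamma function *)

(** The condition 0 < s < 1 drives both halves. The binomial coefficients of [(t/c)^(s-1)] in powers
    of [1 - t/c] are nonnegative because 1 - s > 0, so termwise integration is monotone convergence.
    Convergence of the Gauss series is then a by-product of the finiteness of the integral, even at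
    h = 0, where its argument is 1, on the boundary of the disc. The obstacle to uniformity is that
    the lower endpoints [c |h|^2 / a^2] and [|h|^2 / b^2] may be far apart for large h. Their ratio
    [c b^2 / a^2], however, does not depend on h, and the dominating function 1/t has a
    scale-invariant integral; hence the endpoints are compared multiplicatively. Near t = 0 the
    singularity of [t^(s-1)] is harmless because the difference between [(1 - t/c)^(c-1)] and
    [e^(-t)] carries a factor t. For semidefiniteness, shifting the variable puts all pairs of
    points over one domain of integration, so that the quadratic form can be taken under the
    integral sign; the factor [e^(-x)] released by the shift is itself Gaussian and merges with the
    mixture. *)

Lemma powR_le1D (R : realType) (s t : R) : 0 <= s <= 1 -> 0 <= t -> t `^ s <= 1 + t.
Proof.
move=> /andP[s0 s1] t0; have [t1|t1] := leP t 1.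
  rewrite (@le_trans _ _ 1)//; last by lra.
  by have := @ge0_ler_powR R s s0 t 1; rewrite !nnegrE powR1 => ->.
by rewrite (@le_trans _ _ t)//; [apply: ler1_powR => //; exact: ltW | lra].
Qed.

Lemma powR_split1 (R : realType) (s t : R) : 0 < t -> t `^ s = t * t `^ (s - 1).
Proof.
move=> t0; rewrite -{2}(powRr1 (ltW t0)) -powRD ?(gt_eqF t0) ?implybT//.
by congr (_ `^ _); ring.
Qed.

Lemma measurable_powR_expR (R : realType) (s : R) (D : set R) :
  measurable_fun D (fun t : R => t `^ s * expR (- t)).
Proof.
apply: measurable_funM; first by apply: measurable_funTS; exact: measurable_powR.
apply/measurable_funTS/measurableT_comp => //; exact: measurable_funN.
Qed.

Lemma integral_expRM (R : realType) (k x : R) : 0 < k ->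
  (\int[@mu R]_(t in `[x, +oo[) (expR (- k * t))%:E = (k^-1 * expR (- k * x))%:E)%E.
Proof.
move=> k0.
have cE : continuous (fun t : R => expR (- k * t)).
  move=> t; apply: (@continuous_comp _ _ _ (fun t => - k * t) expR).
    by apply: continuousM; [exact: cst_continuous|exact: id].
  exact: continuous_expR.
rewrite (@ge0_continuous_FTC2y _ _ (fun t => - k^-1 * expR (- k * t)) x 0)//.
- by rewrite sub0e -EFinN; congr EFin; ring.
- exact: continuous_subspaceT.
- rewrite -[X in _ --> X](mulr0 (- k^-1)); apply: cvgMr.
  rewrite (_ : (fun t => expR (- k * t)) = (fun z => expR (- z)) \o (fun z => k * z)).
    by apply: (@cvg_comp _ _ _ _ _ _ (pinfty_nbhs R)); [exact: gt0_cvgMry|exact: cvgr_expR].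
  by apply/funext => t /=; rewrite mulNr.
- apply: cvg_at_right_filter; apply: cvgMr; exact: cE.
- move=> t _; rewrite derive1E derive_val/=; rewrite !scaler1 /GRing.scale/=.
  by field; exact: lt0r_neq0.
Qed.

Lemma integrable_expRM (R : realType) (k x : R) : 0 < k ->
  (@mu R).-integrable `[x, +oo[ (EFin \o (fun t => expR (- k * t))).
Proof.
move=> k0; apply/integrableP; split.
  apply/measurable_EFinP; apply: measurable_funTS; apply: measurableT_comp => //.
under eq_integral do rewrite /= ger0_norm ?expR_ge0//.
by rewrite integral_expRM// ltry.
Qed.

(** For s < 1 the integrand is unbounded at 0, so the fundamental theorem is applied on
    [[1/(n+1), 1]] and the bound passes to the union by monotone convergence. *)
Lemma integral_powR01_le (R : realType) (s : R) : 0 < s ->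
  (\int[@mu R]_(t in `]0%R, 1%R]) (t `^ (s - 1))%:E <= (s^-1)%:E)%E.
Proof.
move=> s0.
pose A n : set R := `[n.+1%:R^-1, 1]%classic.
have UA : \bigcup_n A n = `]0, 1]%classic.
  apply/seteqP; split => t /=; rewrite /A /= ?in_itv/=.
    move=> [n _]; rewrite /= in_itv/= => /andP[nt ->]; rewrite andbT.
    by apply: lt_le_trans nt; rewrite invr_gt0.
  move=> /andP[t0 t1]; have := archi_boundP (ltW (_ : 0 < t^-1)).
  rewrite invr_gt0 => /(_ t0); set N := Num.bound _ => tn; exists N => //=.
  rewrite in_itv/= t1 andbT -(invrK t) lef_pV2 ?posrE ?invr_gt0//.
  by rewrite (le_trans (ltW tn))// ler_nat.
rewrite -UA.
have mf n : measurable_fun (A n) (fun t => (t `^ (s - 1))%:E).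
  by apply/measurable_EFinP; apply: measurable_funTS; exact: measurable_powR.
have cA : (\int[@mu R]_(t in A n) (t `^ (s - 1))%:E)%E @[n --> \oo] -->
    (\int[@mu R]_(t in \bigcup_n A n) (t `^ (s - 1))%:E)%E.
  apply: ge0_nondecreasing_set_cvg_integral => //.
  - apply/nondecreasing_seqP => n; rewrite subsetEset /A => t /=.
    rewrite !in_itv/= => /andP[nt ->]; rewrite andbT; apply: le_trans nt.
    by rewrite lef_pV2 ?posrE// ler_nat.
  - by move=> n; exact: measurable_itv.
  - by move=> n t _; rewrite lee_fin powR_ge0.
rewrite -(cvg_lim _ cA)//; apply: lime_le.
  by apply/cvg_ex; eexists; exact: cA.
(* For index 0 the interval is the single point 1, where the integral vanishes. *)
apply: nearW => -[|n].
  rewrite /A invr1 set_itv1 integral_set1 lee_fin invr_ge0; exact: ltW.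
have n1 : n.+2%:R^-1 < 1 :> R by rewrite invf_lt1// ltr1n.
have n0 : 0 < n.+2%:R^-1 :> R by rewrite invr_gt0.
have cp (q t : R) : 0 < t -> {for t, continuous (@powR R ^~ q)}.
  move=> t0; apply/differentiable_continuous/derivable1_diffP.
  by apply: ex_derive; exact: is_derive1_powR.
rewrite (@continuous_FTC2 _ _ (fun t => s^-1 * t `^ s))//.
- by rewrite -EFinB lee_fin powR1 mulr1 gerBl mulr_ge0 ?powR_ge0// invr_ge0 ltW.
- apply: continuous_in_subspaceT => t; rewrite inE/= in_itv/= => /andP[nt _].
  by apply: cp; exact: lt_le_trans nt.
- split.
  + move=> t; rewrite in_itv/= => /andP[nt _]; have t0 := lt_trans n0 nt.
    by apply: derivableM => //; apply: ex_derive; exact: is_derive1_powR.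
  + by apply: cvg_at_right_filter; apply: cvgMr; exact: cp.
  + by apply: cvg_at_left_filter; apply: cvgMr; exact: cp.
- move=> t; rewrite in_itv/= => /andP[nt _]; have t0 := lt_trans n0 nt.
  have dp : derivable (@powR R ^~ s) t 1 by apply: ex_derive; exact: is_derive1_powR.
  rewrite derive1E deriveM//= derive_cst scaler0 addr0.
  rewrite -derive1E powR_derive1 ?in_itv/= ?t0// /GRing.scale/=.
  by rewrite mulrA mulVf ?mul1r// lt0r_neq0.
Qed.

(** A single term of the exponential series suffices: with n + 1 >= q, [(t/2)^(n+1) / (n+1)!] is at
    most [e^(t/2)]. Half of the decay of [e^(-t)] remains available after this bound. *)
Lemma powR_le_expR_half (R : realType) (q : R) :
  exists2 K : R, 0 < K & forall t, 1 <= t -> t `^ q <= K * expR (t / 2).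
Proof.
pose n := Num.bound `|q|.
exists (2 ^+ n.+1 * n.+1`!%:R) => [|t t1].
  by rewrite mulr_gt0 ?exprn_gt0// ltr0n fact_gt0.
have t0 : 0 <= t by exact: le_trans t1.
have nq : q <= n.+1%:R.
  rewrite (le_trans (ler_norm q))// (le_trans (ltW (archi_boundP (normr_ge0 q))))//.
  by rewrite ler_nat.
apply: (le_trans (ler_powR t1 nq)); rewrite powR_mulrn//.
have := @expR_ge1Dxn R (t / 2) n; rewrite divr_ge0// => /(_ isT) H.
have f0 : 0 < n.+1`!%:R :> R by rewrite ltr0n fact_gt0.
have : (t / 2) ^+ n.+1 / n.+1`!%:R <= expR (t / 2) by lra.
rewrite ler_pdivrMr// expr_div_n ler_pdivrMr ?exprn_gt0//.
by move/le_trans; apply; rewrite le_eqVlt; apply/orP; left; apply/eqP; ring.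
Qed.

(** Comparison with [t^(s-1)] on []0, 1]] and with a multiple of [e^(-t/2)] beyond 1. *)
Lemma integrable_gamma (R : realType) (s : R) : 0 < s ->
  (@mu R).-integrable `[0, +oo[ (EFin \o (fun t => t `^ (s - 1) * expR (- t))).
Proof.
move=> s0; set f := (X in EFin \o X).
have mf D : measurable_fun D f by exact: measurable_powR_expR.
have f0 t : 0 <= f t by rewrite mulr_ge0 ?powR_ge0 ?expR_ge0.
apply/integrableP; split; first by apply/measurable_EFinP; exact: mf.
under eq_integral do rewrite /= ger0_norm//.
rewrite -integral_itv_obnd_cbnd; last exact/measurable_EFinP.
rewrite (@itv_bndbnd_setU _ _ _ (BRight 1)) ?bnd_simp//.
rewrite ge0_integral_setU//=; last 3 first.
- by apply/measurable_EFinP; exact: mf.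
- by move=> t _; rewrite lee_fin.
- apply/disj_setPS => t [] /=; rewrite !in_itv/= => /andP[_ t1]; rewrite andbT.
  by rewrite ltNge t1.
apply: lte_add_pinfty.
  apply: le_lt_trans (ltry s^-1); apply: le_trans (integral_powR01_le s0).
  apply: ge0_le_integral => //=.
  - by move=> t _; rewrite lee_fin.
  - by apply/measurable_EFinP; exact: mf.
  - by apply/measurable_EFinP; apply: measurable_funTS; exact: measurable_powR.
  - move=> t; rewrite in_itv/= => /andP[t0 _]; rewrite lee_fin /f.
    by rewrite ler_piMr ?powR_ge0// expR_le1 oppr_le0 ltW.
have [K K0 HK] := powR_le_expR_half (s - 1).
apply: (@le_lt_trans _ _ (\int[mu]_(t in `]1%R, +oo[) (K%:E * (expR (- 2^-1 * t))%:E))%E).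
  apply: ge0_le_integral => //=.
  - by move=> t _; rewrite lee_fin.
  - by apply/measurable_EFinP; exact: mf.
  - apply/measurable_EFinP; apply: measurable_funM => //.
    by apply: measurable_funTS; apply: measurableT_comp.
  - move=> t; rewrite in_itv/= andbT => t1; rewrite -EFinM lee_fin /f.
    have -> : expR (- 2^-1 * t) = expR (t / 2) * expR (- t).
      by rewrite -expRD; congr expR; lra.
    by rewrite mulrA ler_wpM2r ?expR_ge0// HK// ltW.
have h0 : 0 < 2^-1 :> R by rewrite invr_gt0.
rewrite integral_itv_obnd_cbnd; last first.
  apply/measurable_EFinP; apply: measurable_funM => //.
  by apply: measurable_funTS; apply: measurableT_comp.
rewrite ge0_integralZl_EFin//=; first by rewrite integral_expRM// -EFinM ltry.
- by apply/measurable_EFinP; apply: measurable_funTS; apply: measurableT_comp.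
- exact: ltW.
Qed.

Lemma Gamma_gt0 (R : realType) (s : R) : 0 < s -> 0 < Gamma s.
Proof.
move=> s0; have ig := integrable_gamma s0.
(* On [[1, 2]] the power is at least 1/t >= 1/2, since s - 1 > -1, and the exponential is at least
   [e^(-2)]. *)
apply: (@lt_le_trans _ _ (\int[mu]_(t in `[1, 2]) (2^-1 * expR (-2)))).
  rewrite Rintegral_cst//= lebesgue_measure_itv/= lte_fin ltr1n /=.
  by rewrite mulr_gt0 ?mulr_gt0 ?invr_gt0 ?expR_gt0//; lra.
have m12 : measurable (`[1, 2] : set (measurableTypeR R)) by exact: measurable_itv.
rewrite /Gamma /Rintegral fine_le//=.
- by rewrite integral_cst//= lebesgue_measure_itv/= lte_fin ltr1n.
- exact: integrable_fin_num.
apply: (@le_trans _ _ (\int[mu]_(t in `[1%R, 2%R]) (t `^ (s - 1) * expR (- t))%:E)%E).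
  apply: ge0_le_integral => //=.
  - by apply/measurable_EFinP; exact: measurable_powR_expR.
  - move=> t; rewrite in_itv/= => /andP[t1 t2]; rewrite lee_fin.
    rewrite ler_pM ?expR_ge0 ?invr_ge0//; last by rewrite ler_expR lerN2.
    apply: (@le_trans _ _ (t `^ (- 1))).
      rewrite powR_inv1; last by lra.
      by rewrite lef_pV2 ?posrE//; lra.
    by apply: ler_powR => //; lra.
apply: ge0_subset_integral => //=.
- by apply/measurable_EFinP; exact: measurable_powR_expR.
- by move=> t _; rewrite lee_fin mulr_ge0 ?expR_ge0 ?powR_ge0.
- by move=> t /=; rewrite !in_itv/= => /andP[t1 _]; rewrite andbT; lra.
Qed.

Lemma cvg_powR_expR_pinfty (R : realType) (q : R) :
  t `^ q * expR (- t) @[t --> +oo] --> (0 : R).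
Proof.
have [K K0 HK] := powR_le_expR_half q.
apply: (@squeeze_cvgr _ _ _ _ (fun=> 0) (fun t => K * expR (- (2^-1 * t)))).
- near=> t; have t1 : 1 <= t by near: t; apply: nbhs_pinfty_ge; exact: num_real.
  rewrite mulr_ge0 ?powR_ge0 ?expR_ge0//=.
  have -> : expR (- (2^-1 * t)) = expR (t / 2) * expR (- t).
    by rewrite -expRD; congr expR; lra.
  rewrite mulrA ler_wpM2r ?expR_ge0//; exact: HK.
- exact: cvg_cst.
- rewrite -[X in _ --> X](mulr0 K); apply: cvgMr.
  apply: (@cvg_comp _ _ _ (fun t => 2^-1 * t) (fun z => expR (- z)) _ (pinfty_nbhs R)).
    by apply: gt0_cvgMry => //; rewrite invr_gt0.
  exact: cvgr_expR.
Unshelve. all: by end_near. Qed.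

Lemma continuous_powR (R : realType) (q t : R) : 0 < t -> {for t, continuous (@powR R ^~ q)}.
Proof.
move=> t0; apply/differentiable_continuous/derivable1_diffP.
by apply: ex_derive; exact: is_derive1_powR.
Qed.

Lemma is_derive_powR_expR (R : realType) (c t : R) : 0 < t ->
  is_derive t 1 (fun t => t `^ c * expR (- t))
    (c * t `^ (c - 1) * expR (- t) - t `^ c * expR (- t)).
Proof.
move=> t0; have dp := is_derive1_powR c t0.
apply: is_derive_eq => /=.
rewrite /GRing.scale/=; ring.
Qed.

(** Integration by parts in disguise: [f] is the derivative of [F], which vanishes at 0 and at
    infinity. The fundamental theorem on a half-line asks for a constant sign, and [f] has the sign
    of c - t; hence the split at c, whose pieces contribute [F c] and [- F c]. The assumption 1 < c
    makes [f] continuous at 0. *)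
Lemma GammaD1 (R : realType) (c : R) : 1 < c -> Gamma (c + 1) = c * Gamma c.
Proof.
move=> c1; have c0 : 0 < c by lra.
pose f t : R := c * (t `^ (c - 1) * expR (- t)) - t `^ (c + 1 - 1) * expR (- t).
pose F t : R := t `^ c * expR (- t).
have fE t : f t = c * t `^ (c - 1) * expR (- t) - t `^ c * expR (- t).
  by rewrite /f mulrA addrK.
have i1 : (@mu R).-integrable `[0, +oo[ (EFin \o (fun t => c * (t `^ (c - 1) * expR (- t)))).
  by apply: (integrableZl _ _ (integrable_gamma _)) => //; lra.
have i2 : (@mu R).-integrable `[0, +oo[ (EFin \o (fun t => t `^ (c + 1 - 1) * expR (- t))).
  by apply: integrable_gamma; lra.
have If : (@mu R).-integrable `[0, +oo[ (EFin \o f).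
  by have := integrableB _ i1 i2; apply.
have cf : {within `[0, +oo[, continuous f}.
  have cE : continuous (fun t : R => expR (- t)).
    move=> t; apply: continuous_comp; first exact: continuousN.
    exact: continuous_expR.
  apply/continuous_within_itvcyP; split.
    move=> t; rewrite in_itv/= andbT => t0; rewrite /continuous_at /f; apply: cvgB.
      apply: cvgM; first exact: cvg_cst.
      by apply: cvgM; [exact: continuous_powR | exact: cE].
    by apply: cvgM; [exact: continuous_powR | exact: cE].
  have cE0 := cvg_at_right_filter (cE 0).
  rewrite /f !powR0; [|lra..]; apply: cvgB.
    apply: cvgM; first exact: cvg_cst.
    by apply: cvgM => //; apply: powR_cvg0; lra.
  by apply: cvgM => //; apply: powR_cvg0; lra.
have dF (t : R) : 0 < t -> is_derive t 1 F (f t).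
  by move=> t0; rewrite fE; exact: is_derive_powR_expR.
have cF (t : R) : 0 < t -> {for t, continuous F}.
  move=> t0; apply/differentiable_continuous/derivable1_diffP.
  by apply: ex_derive; exact: dF.
have F0 : F x @[x --> 0^'+] --> F 0.
  rewrite /F powR0 ?gt_eqF//; apply: cvgM; first exact: powR_cvg0.
  apply: cvg_at_right_filter; apply: continuous_comp; first exact: continuousN.
  exact: continuous_expR.
have f_ge0 (t : R) : 0 < t -> f t = t `^ (c - 1) * expR (- t) * (c - t).
  by move=> t0; rewrite fE (powR_split1 c t0); ring.
have E1 : \int[@mu R]_(t in `[0, c]) f t = F c.
  rewrite /Rintegral (@continuous_FTC2 _ _ F)//=.
  - by rewrite /F powR0 ?gt_eqF// mul0r subr0.
  - by apply: continuous_subspaceW cf => t /=; rewrite !in_itv/= => /andP[->].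
  - split => //.
    + by move=> t; rewrite in_itv/= => /andP[t0 _]; apply: ex_derive; exact: dF.
    + by apply: cvg_at_left_filter; exact: cF.
  - move=> t; rewrite in_itv/= => /andP[t0 _].
    by rewrite derive1E; apply: derive_val; exact: dF.
have E2 : \int[@mu R]_(t in `]c, +oo[) f t = - F c.
  rewrite Rintegral_itv_obnd_cbnd; last first.
    by apply: integrableS If => // t /=; rewrite !in_itv/= !andbT; lra.
  rewrite /Rintegral (@le0_continuous_FTC2y _ _ F _ 0)//=.
  - by rewrite sub0r.
  - move=> t ct; rewrite f_ge0; last by lra.
    by rewrite mulr_ge0_le0 ?mulr_ge0 ?powR_ge0 ?expR_ge0//; lra.
  - by apply: continuous_subspaceW cf => t /=; rewrite !in_itv/= !andbT; lra.
  - exact: cvg_powR_expR_pinfty.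
  - by apply: cvg_at_right_filter; exact: cF.
  - by move=> t ct; apply: ex_derive; apply: dF; lra.
  - move=> t; rewrite in_itv/= andbT => ct.
    by rewrite derive1E; apply: derive_val; apply: dF; lra.
have := @Rintegral_itvB R f (BLeft 0) +oo%O c If.
rewrite !bnd_simp => /(_ (ltW c0) isT); rewrite E1 E2 => /eqP.
rewrite subr_eq addNr /f RintegralB//= RintegralZl//; last exact: integrable_gamma.
by rewrite subr_eq0 => /eqP H; rewrite /Gamma -H.
Qed.

(** * Wendel's inequality *)

Lemma weighted_AM_GM1 (R : realType) (s u : R) : 0 <= s <= 1 -> 0 < u ->
  u `^ s <= s * u + (1 - s).
Proof.
move=> /andP[s0 s1] u0; set m := u `^ s.
(* Apply 1 + ln v <= v to v = u / m and v = 1 / m, with weights s and 1 - s. *)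
have m0 : 0 < m by exact: powR_gt0.
have L (v : R) : 0 < v -> 1 + ln v <= v.
  move=> v0; have := @le_ln1Dx _ (v - 1).
  have -> : 1 + (v - 1) = v by ring.
  by move=> H; have := H ltac:(lra); lra.
have Lu : 1 + (ln u - s * ln u) <= u / m.
  have := L (u / m) (divr_gt0 u0 m0); rewrite ln_div ?posrE//.
  by rewrite /m ln_powR.
have L1 : 1 - s * ln u <= m^-1.
  by have := L m^-1; rewrite invr_gt0 => /(_ m0); rewrite lnV ?posrE// /m ln_powR.
have H : 1 <= s * (u / m) + (1 - s) * m^-1.
  have A := ler_wpM2l s0 Lu; have B : 0 <= 1 - s by lra.
  have C := ler_wpM2l B L1.
  apply: le_trans (lerD A C); rewrite le_eqVlt; apply/orP; left; apply/eqP; ring.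
have -> : s * u + (1 - s) = (s * (u / m) + (1 - s) * m^-1) * m.
  by field; exact: lt0r_neq0.
by rewrite ler_peMl// ltW.
Qed.

(** Pointwise weighted AM-GM at u = t/c replaces Hölder: [t^s <= c^s (s t/c + 1 - s)]. Against
    [t^(c-1) e^(-t)] the bracket integrates to exactly [Gamma c], because
    [Gamma (c + 1) = c * Gamma c]. *)
Lemma Gamma_wendel (R : realType) (c s : R) : 1 < c -> 0 <= s <= 1 ->
  Gamma (c + s) <= c `^ s * Gamma c.
Proof.
move=> c1 /andP[s0 s1]; have c0 : 0 < c by lra.
have i1 : (@mu R).-integrable `[0, +oo[ (EFin \o (fun t => c `^ s * (1 - s) * (t `^ (c - 1) * expR (- t)))).
  by apply: (integrableZl _ _ (integrable_gamma _)) => //; lra.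
have i2 : (@mu R).-integrable `[0, +oo[ (EFin \o (fun t => c `^ s * s / c * (t `^ (c + 1 - 1) * expR (- t)))).
  by apply: (integrableZl _ _ (integrable_gamma _)) => //; lra.
apply: (@le_trans _ _ (\int[mu]_(t in `[0, +oo[) (c `^ s * (1 - s) * (t `^ (c - 1) * expR (- t)) +
   c `^ s * s / c * (t `^ (c + 1 - 1) * expR (- t))))).
  apply: le_Rintegral => //.
  - by apply: integrable_gamma; lra.
  - by have := integrableD _ i1 i2; apply.
  - move=> t /=; rewrite in_itv/= andbT le_eqVlt => /predU1P[<-|t0].
      rewrite !powR0 ?mul0r ?mulr0 ?addr0//; apply/eqP; lra.
    have := @weighted_AM_GM1 R s (t / c); rewrite s0 s1 divr_gt0// => /(_ isT isT) H.
    have tc : t `^ s = c `^ s * (t / c) `^ s.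
      rewrite -powRM ?divr_ge0 ?ltW//; congr (_ `^ _); field; exact: lt0r_neq0.
    have -> : t `^ (c + s - 1) = t `^ (c - 1) * t `^ s.
      by rewrite -powRD ?(gt_eqF t0) ?implybT//; congr (_ `^ _); ring.
    rewrite addrK (powR_split1 c t0) tc.
    have P : 0 <= t `^ (c - 1) * expR (- t) * c `^ s.
      by rewrite !mulr_ge0 ?powR_ge0 ?expR_ge0.
    have := ler_wpM2l P H; set A := (X in X <= _ -> _); set B := (X in _ <= X -> _) => AB.
    apply: le_trans (_ : A <= _); first by rewrite /A le_eqVlt; apply/orP; left; apply/eqP; ring.
    apply: (le_trans AB); rewrite /B le_eqVlt; apply/orP; left; apply/eqP.
    by field; exact: lt0r_neq0.
rewrite RintegralD//= RintegralZl//; last exact: integrable_gamma.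
rewrite RintegralZl//; last by apply: integrable_gamma; lra.
rewrite -/(Gamma c) -/(Gamma (c + 1)) GammaD1// le_eqVlt; apply/orP; left; apply/eqP.
by field; exact: lt0r_neq0.
Qed.

(** The upper bound is Wendel at c with increment s; the lower one is Wendel at c + s with increment
    1 - s, which leaves [(c/(c+s))^(1-s) >= c/(c+s)]. The constant kappa_c is thus within 1/c of 1
    from below. *)
Lemma Gamma_ratio_bounds (R : realType) (c s : R) : 1 < c -> 0 <= s <= 1 ->
  1 - s / (c + s) <= Gamma (c + s) * c `^ (1 - s) / Gamma (c + 1) <= 1.
Proof.
move=> c1 s01; have /andP[s0 s1] := s01; have c0 : 0 < c by lra.
have cs0 : 0 < c + s by lra.
have r0 : 0 < c / (c + s) by rewrite divr_gt0.
have r1 : c / (c + s) <= 1 by rewrite ler_pdivrMr// mul1r; lra.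
have E : 1 - s / (c + s) = c / (c + s) by field; lra.
have cs : c `^ s * c `^ (1 - s) = c.
  by rewrite -powRD ?(gt_eqF c0) ?implybT// addrC subrK powRr1// ltW.
have D : c `^ (1 - s) = (c / (c + s)) `^ (1 - s) * (c + s) `^ (1 - s).
  by rewrite -powRM ?(ltW r0) ?(ltW cs0)// divfK ?lt0r_neq0.
have P : c / (c + s) <= (c / (c + s)) `^ (1 - s).
  by apply: ger1_powR; [rewrite r0 r1 | lra].
have s01' : 0 <= 1 - s <= 1 by lra.
have cs1 : 1 < c + s by lra.
have A : c + s + (1 - s) = c + 1 by ring.
have c2 : 0 < c + 1 by lra.
have W1 := Gamma_wendel c1 s01.
have W2 := Gamma_wendel cs1 s01'.
have G1 := Gamma_gt0 c2; have Gs := Gamma_gt0 cs0.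
have GD := GammaD1 c1.
rewrite A in W2; rewrite E.
move: (Gamma (c + 1)) (Gamma c) (Gamma (c + s)) G1 Gs GD W1 W2 => g1 g gs G1 Gs GD W1 W2.
apply/andP; split.
  rewrite ler_pdivlMr// D.
  apply: (le_trans (ler_wpM2l (ltW r0) W2)).
  have := ler_wpM2r (mulr_ge0 (powR_ge0 (c + s) (1 - s)) (ltW Gs)) P.
  by rewrite [gs * _]mulrC -[X in _ -> _ <= X]mulrA.
rewrite ler_pdivrMr// mul1r GD -[X in _ <= X * _]cs.
by rewrite mulrAC ler_wpM2r ?powR_ge0.
Qed.

(** * Positive semidefiniteness *)

Lemma cvg_bigsum (R : realType) (I : Type) (r : seq I) (f : I -> nat -> R) (l : I -> R) :
  (forall i, f i N @[N --> \oo] --> l i) ->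
  (\sum_(i <- r) f i N) @[N --> \oo] --> \sum_(i <- r) l i.
Proof.
move=> fl; elim: r => [|i r IH].
  by under eq_fun do rewrite big_nil; rewrite big_nil; exact: cvg_cst.
by under eq_fun do rewrite big_cons; rewrite big_cons; exact: cvgD.
Qed.

(** Expanding the k-th power of the inner product over all maps f from k to d gives the explicit
    feature map of the k-th tensor power; each f contributes a perfect square. *)
Lemma quad_form_mono (R : realType) (d n k : nat) (x : 'I_n -> 'rV[R]_d) (w : 'I_n -> R) :
  0 <= \sum_(i < n) \sum_(j < n) w i * w j * (\sum_(l < d) x i ord0 l * x j ord0 l) ^+ k.
Proof.
pose W (f : {ffun 'I_k -> 'I_d}) i := w i * \prod_(m < k) x i ord0 (f m).
have E i j : w i * w j * (\sum_(l < d) x i ord0 l * x j ord0 l) ^+ k =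
    \sum_(f : {ffun 'I_k -> 'I_d}) W f i * W f j.
  have -> : (\sum_(l < d) x i ord0 l * x j ord0 l) ^+ k =
      \prod_(m < k) \sum_(l < d) x i ord0 l * x j ord0 l by rewrite prodr_const card_ord.
  rewrite bigA_distr_bigA/= mulr_sumr; apply: eq_bigr => f _.
  by rewrite big_split/= /W; ring.
under eq_bigr => i _ do rewrite (eq_bigr _ (fun j _ => E i j)) exchange_big/=.
rewrite exchange_big/=; apply: sumr_ge0 => f _.
have -> : \sum_(i < n) \sum_(j < n) W f i * W f j = (\sum_(i < n) W f i) ^+ 2.
  rewrite expr2 mulr_suml; apply: eq_bigr => i _.
  by rewrite mulr_sumr.
exact: sqr_ge0.
Qed.

(** The exponential series has nonnegative coefficients, so each partial sum is a nonnegative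
    combination of the monomial forms, and the sign survives the limit. *)
Lemma quad_form_expR (R : realType) (d n : nat) (x : 'I_n -> 'rV[R]_d) (w : 'I_n -> R) (k : R) :
  0 <= k ->
  0 <= \sum_(i < n) \sum_(j < n) w i * w j * expR (k * \sum_(l < d) x i ord0 l * x j ord0 l).
Proof.
move=> k0; pose g i j := \sum_(l < d) x i ord0 l * x j ord0 l.
pose u (N : nat) : R := \sum_(i < n) \sum_(j < n) w i * w j * series (exp_coeff (k * g i j)) N.
have cu : u N @[N --> \oo] --> \sum_(i < n) \sum_(j < n) w i * w j * expR (k * g i j).
  apply: cvg_bigsum => i; apply: cvg_bigsum => j.
  by apply: cvgMr; exact: is_cvg_series_exp_coeff.
rewrite -(cvg_lim _ cu)//; apply: limr_ge; first by apply/cvg_ex; eexists; exact: cu.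
apply: nearW => N; rewrite /u.
under eq_bigr => i _ do under eq_bigr => j _ do rewrite /series/= mulr_sumr.
under eq_bigr => i _ do rewrite exchange_big/=.
rewrite exchange_big/=; apply: sumr_ge0 => m _.
have -> : \sum_(i < n) \sum_(j < n) w i * w j * exp_coeff (k * g i j) m =
    k ^+ m / m`!%:R * \sum_(i < n) \sum_(j < n) w i * w j * g i j ^+ m.
  rewrite mulr_sumr; apply: eq_bigr => i _; rewrite mulr_sumr; apply: eq_bigr => j _.
  by rewrite /exp_coeff/= exprMn; ring.
by rewrite mulr_ge0 ?quad_form_mono// divr_ge0 ?exprn_ge0.
Qed.

Lemma sqr_eucl_norm (R : realType) (d : nat) (h : 'rV[R]_d) :
  eucl_norm h ^+ 2 = \sum_(i < d) h ord0 i ^+ 2.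
Proof. by rewrite sqr_sqrtr// sumr_ge0// => i _; exact: sqr_ge0. Qed.

(** By polarization, [|x - y|^2 = |x|^2 + |y|^2 - 2 <x, y>]; the factors depending on one point only
    are absorbed into the weights, leaving the exponential of the inner product. *)
Lemma quad_form_gauss (R : realType) (d n : nat) (x : 'I_n -> 'rV[R]_d) (w : 'I_n -> R) (k : R) :
  0 <= k ->
  0 <= \sum_(i < n) \sum_(j < n) w i * w j * expR (- (k * eucl_norm (x i - x j) ^+ 2)).
Proof.
move=> k0; pose q (i : 'I_n) := \sum_(l < d) x i ord0 l ^+ 2.
have := @quad_form_expR R d n x (fun i => w i * expR (- (k * q i))) (2 * k).
rewrite mulr_ge0// => /(_ isT); congr (0 <= _).
apply: eq_bigr => i _; apply: eq_bigr => j _.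
have -> : - (k * eucl_norm (x i - x j) ^+ 2) =
    - (k * q i) + - (k * q j) + 2 * k * \sum_(l < d) x i ord0 l * x j ord0 l.
  have -> : eucl_norm (x i - x j) ^+ 2 = q i + q j - 2 * \sum_(l < d) x i ord0 l * x j ord0 l.
    rewrite sqr_eucl_norm mulr_sumr -big_split/= -sumrB.
    by apply: eq_bigr => l _; rewrite !mxE; ring.
  by ring.
by rewrite !expRD; ring.
Qed.

Lemma quad_form_integral (R : realType) (D : set (measurableTypeR R)) (n : nat) (w : 'I_n -> R)
    (K : 'I_n -> 'I_n -> R -> R) : measurable D ->
  (forall i j, (@mu R).-integrable D (EFin \o K i j)) ->
  (forall s, D s -> 0 <= \sum_(i < n) \sum_(j < n) w i * w j * K i j s) ->
  0 <= \sum_(i < n) \sum_(j < n) w i * w j * \int[@mu R]_(s in D) K i j s.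
Proof.
move=> mD iK K0.
pose f (p : 'I_n * 'I_n) s := w p.1 * w p.2 * K p.1 p.2 s.
have If p : (@mu R).-integrable D (EFin \o f p).
  by apply: (integrableZl _ _ (iK p.1 p.2)).
(* The induction carries integrability along with linearity, since each addition of integrals
   requires both summands to be integrable. *)
have L (r : seq ('I_n * 'I_n)) : (@mu R).-integrable D (EFin \o (fun s => \sum_(p <- r) f p s)) /\
   \int[@mu R]_(s in D) (\sum_(p <- r) f p s) = \sum_(p <- r) \int[@mu R]_(s in D) f p s.
  elim: r => [|p r [IH1 IH2]].
    split.
      have -> : (fun s => \sum_(p <- [::]) f p s) = cst 0 by apply/funext => s; rewrite big_nil.
      exact: integrable0.
    under eq_Rintegral do rewrite big_nil.
    by rewrite big_nil /Rintegral integral0.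
  have E : (fun s => \sum_(p <- p :: r) f p s) = (fun s => f p s + \sum_(p <- r) f p s).
    by apply/funext => s; rewrite big_cons.
  rewrite E big_cons -IH2; split; last by rewrite RintegralD.
  by have := integrableD mD (If p) IH1; apply.
have -> : \sum_(i < n) \sum_(j < n) w i * w j * \int[@mu R]_(s in D) K i j s =
    \int[@mu R]_(s in D) (\sum_(p : 'I_n * 'I_n) f p s).
  rewrite (L _).2 pair_bigA/=; apply: eq_bigr => p _.
  by rewrite /f RintegralZl.
apply: Rintegral_ge0 => s Ds; rewrite -(pair_bigA _ (fun i j => f (i, j) s))/=.
exact: K0.
Qed.

(* Integrand of Gamma p * A `^ (- p) after the substitution v = expR t, which turns
   the scaling by A into a translation and has no singularity. *)
Definition powR_kernel (R : realType) (p A t : R) : R := expR (p * t - A * expR t).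

Lemma measurable_powR_kernel (R : realType) (p A : R) (D : set R) :
  measurable_fun D (powR_kernel p A).
Proof.
apply: measurable_funTS; apply: measurableT_comp => //.
apply: measurable_funB => //; apply: measurable_funM => //.
Qed.


Lemma ge0_integral_lty_expR (R : realType) (f : R -> R) (q : R) :
  measurable_fun setT f -> 0 < q -> (forall t, 0 <= t -> 0 <= f t <= expR (- q * t)) ->
  (\int[@mu R]_(t in `[0%R, +oo[) (f t)%:E < +oo)%E.
Proof.
move=> mf q0 H; apply: (@le_lt_trans _ _ (\int[@mu R]_(t in `[0%R, +oo[) (expR (- q * t))%:E)%E).
  apply: ge0_le_integral => //=.
  - by move=> t; rewrite in_itv/= andbT => /H/andP[]; rewrite lee_fin.
  - by apply/measurable_EFinP; exact: measurable_funTS.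
  - by apply/measurable_EFinP; apply: measurable_funTS; apply: measurableT_comp.
  - by move=> t; rewrite in_itv/= andbT => /H/andP[]; rewrite lee_fin.
by rewrite integral_expRM// ltry.
Qed.

(** For t >= 0, [e^t >= 1 + t] bounds the exponent by -(1 - p) t; for t <= 0, after reflection,
    dropping the double exponential leaves the decay [e^(-p t)]. *)
Lemma integrable_powR_kernel (R : realType) (p : R) : 0 < p < 1 ->
  (@mu R).-integrable setT (EFin \o powR_kernel p 1).
Proof.
move=> /andP[p0 p1].
have mf D : measurable_fun D (EFin \o powR_kernel p 1).
  by apply/measurable_EFinP; exact: measurable_powR_kernel.
apply/integrableP; split; first exact: mf.
under eq_integral do rewrite /= ger0_norm ?expR_ge0//.
rewrite -(setUv `[0, +oo[%classic) ge0_integral_setU//=; last 4 first.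
- exact: measurableC.
- exact: mf.
- by move=> t _; rewrite lee_fin expR_ge0.
- exact/disj_setPCl.
apply: lte_add_pinfty.
  apply: (@ge0_integral_lty_expR _ _ (1 - p)); [exact: measurable_powR_kernel|lra|].
  move=> t t0; rewrite expR_ge0 ler_expR; have := expR_ge1Dx t; lra.
rewrite setCitvr integral_itv_bndo_bndc; last exact: mf.
pose g t := powR_kernel p 1 (- t).
have mg : measurable_fun setT g.
  apply: (@measurableT_comp _ _ _ _ _ _ (powR_kernel p 1)).
    exact: measurable_powR_kernel.
  exact: measurable_funN.
have := @ge0_integration_by_substitution0 R (fun t => (g t)%:E).
under [in X in _ -> _ -> _ = X]eq_integral do rewrite /g opprK.
move=> <-; last 2 first.
- by apply/measurable_EFinP.
- by move=> r; rewrite lee_fin expR_ge0.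
apply: (@ge0_integral_lty_expR _ _ p) => // t t0.
rewrite expR_ge0 ler_expR; have := expR_ge0 (- t); lra.
Qed.

(** This constant is the common factor by which [quad_form_powR] divides. *)
Lemma integral_powR_kernel_gt0 (R : realType) (p : R) : 0 < p < 1 ->
  0 < \int[@mu R]_t powR_kernel p 1 t.
Proof.
move=> p01; have ip := integrable_powR_kernel p01; move: p01 => /andP[p0 p1].
apply: (@lt_le_trans _ _ (\int[@mu R]_(t in `[0, 1]) (expR (- expR 1)))).
  rewrite Rintegral_cst//= lebesgue_measure_itv/= lte_fin ltr01 /=.
  by rewrite oppr0 addr0 mulr1 expR_gt0.
have m01 : measurable (`[0, 1] : set (measurableTypeR R)) by exact: measurable_itv.
rewrite /Rintegral fine_le//=.
- by rewrite integral_cst//= lebesgue_measure_itv/= lte_fin ltr01.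
- exact: integrable_fin_num.
apply: (@le_trans _ _ (\int[@mu R]_(t in `[0%R, 1%R]) (powR_kernel p 1 t)%:E)%E).
  apply: ge0_le_integral => //=.
  - by apply/measurable_EFinP; exact: measurable_powR_kernel.
  - move=> t; rewrite in_itv/= => /andP[t0 t1]; rewrite lee_fin ler_expR mul1r.
    have := ler_expR t 1; rewrite t1 => H; have := mulr_ge0 (ltW p0) t0; lra.
apply: ge0_subset_integral => //=.
- by apply/measurable_EFinP; exact: measurable_powR_kernel.
- by move=> t _; rewrite lee_fin expR_ge0.
Qed.

(** Translation by ln A turns [e^t] into [A e^t] and p t into p t + p ln A. The identity is kept in
    the extended reals because integrability for general A is deduced from it. *)
Lemma powR_kernel_shift (R : realType) (p A : R) : 0 < A ->
  (\int[@mu R]_t (powR_kernel p 1 t)%:E = (A `^ p)%:E * \int[@mu R]_t (powR_kernel p A t)%:E)%E.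
Proof.
move=> A0.
have dF : (fun t : R => t + ln A)^`()%classic = cst 1.
  by apply/funext => t; rewrite derive1E derive_val addr0.
have cA : continuous (fun t : R => t + ln A).
  by move=> t; apply: cvgD; [exact: cvg_id|exact: cvg_cst].
rewrite (@increasing_ge0_integration_by_substitutionT _ (fun t => t + ln A) (powR_kernel p 1)); first last.
- by move=> t; exact: expR_ge0.
- move=> t; apply: continuous_comp; last exact: continuous_expR.
  apply: cvgB; first by apply: cvgMr.
  by apply: cvgMr; exact: continuous_expR.
- exact: cvg_addrr.
- exact: cvg_addrr_Ny.
- by move=> t; apply: ex_derive.
- by rewrite dF; exact: is_cvg_cst.
- by rewrite dF; exact: is_cvg_cst.
- by rewrite dF; exact: cst_continuous.
- by move=> x y xy; rewrite ltrD2r.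
rewrite -ge0_integralZl_EFin//; last 3 first.
- by move=> t _; rewrite lee_fin expR_ge0.
- by apply/measurable_EFinP; exact: measurable_powR_kernel.
- exact: powR_ge0.
apply: eq_integral => t _; rewrite dF /= -EFinM; congr EFin.
change (powR_kernel p 1 (t + ln A) * 1 = A `^ p * powR_kernel p A t).
rewrite /powR_kernel mulr1 mul1r.
rewrite /powR (gt_eqF A0) -expRD; congr expR.
by rewrite expRD lnK ?posrE//; ring.
Qed.

Lemma powR_kernel_integrable (R : realType) (p A : R) : 0 < p < 1 -> 0 < A ->
  (@mu R).-integrable setT (EFin \o powR_kernel p A).
Proof.
move=> p01 A0; have /integrableP[_] := integrable_powR_kernel p01.
under eq_integral do rewrite /= ger0_norm ?expR_ge0//.
rewrite (powR_kernel_shift p A0) => fin.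
apply/integrableP; split; first by apply/measurable_EFinP; exact: measurable_powR_kernel.
under eq_integral do rewrite /= ger0_norm ?expR_ge0//.
have Ap : 0 < A `^ p by exact: powR_gt0.
rewrite -(@lte_pmul2l _ (A `^ p)%:E) ?lte_fin//.
by rewrite (lt_le_trans fin)// gt0_muley ?leey// lte_fin.
Qed.

Lemma Rintegral_powR_kernel (R : realType) (p A : R) : 0 < p < 1 -> 0 < A ->
  \int[@mu R]_t powR_kernel p A t = A `^ (- p) * \int[@mu R]_t powR_kernel p 1 t.
Proof.
move=> p01 A0; rewrite [in RHS]/Rintegral (powR_kernel_shift p A0) fineM//.
  by rewrite /= mulrA -powRD ?(gt_eqF A0) ?implybT// addNr powRr0 mul1r.
exact: integrable_fin_num (powR_kernel_integrable p01 A0).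
Qed.

(** With the power written as an integral of [powR_kernel], the integrand at each t is
    [e^(p t - s e^t)] times the Gaussian kernel with parameter [(1 + e^t) k]. The shift s > 0 keeps
    [q i j + s] positive on the diagonal, where [q i i = 0]. *)
Lemma quad_form_powR (R : realType) (d n : nat) (x : 'I_n -> 'rV[R]_d) (w : 'I_n -> R)
    (k p s : R) (q := fun i j => k * eucl_norm (x i - x j) ^+ 2) :
  0 <= k -> 0 < p < 1 -> 0 < s ->
  0 <= \sum_(i < n) \sum_(j < n) w i * w j * (expR (- q i j) * (q i j + s) `^ (- p)).
Proof.
move=> k0 p01 s0; have C0 := integral_powR_kernel_gt0 p01.
have qs i j : 0 < q i j + s.
  by rewrite ltr_wpDl// mulr_ge0// exprn_ge0// sqrtr_ge0.
have iK i j : (@mu R).-integrable setT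
    (EFin \o (fun t => expR (- q i j) * powR_kernel p (q i j + s) t)).
  exact: (integrableZl _ _ (powR_kernel_integrable p01 (qs i j))).
have := @quad_form_integral R setT n w _ measurableT iK.
have -> : \sum_(i < n) \sum_(j < n) w i * w j *
      \int[@mu R]_t (expR (- q i j) * powR_kernel p (q i j + s) t) =
    (\int[@mu R]_t powR_kernel p 1 t) *
    \sum_(i < n) \sum_(j < n) w i * w j * (expR (- q i j) * (q i j + s) `^ (- p)).
  rewrite mulr_sumr; apply: eq_bigr => i _; rewrite mulr_sumr; apply: eq_bigr => j _.
  rewrite RintegralZl//; last exact: powR_kernel_integrable.
  by rewrite Rintegral_powR_kernel//; ring.
rewrite pmulr_rge0//; apply => t _.
have -> : \sum_(i < n) \sum_(j < n) w i * w j * (expR (- q i j) * powR_kernel p (q i j + s) t) =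
   expR (p * t - s * expR t) * \sum_(i < n) \sum_(j < n) w i * w j *
     expR (- ((1 + expR t) * k * eucl_norm (x i - x j) ^+ 2)).
  rewrite mulr_sumr; apply: eq_bigr => i _; rewrite mulr_sumr; apply: eq_bigr => j _.
  have -> : expR (- q i j) * powR_kernel p (q i j + s) t =
      expR (p * t - s * expR t) * expR (- ((1 + expR t) * k * eucl_norm (x i - x j) ^+ 2)).
    by rewrite /powR_kernel -!expRD /q; congr expR; ring.
  by ring.
by rewrite mulr_ge0 ?expR_ge0// quad_form_gauss// mulr_ge0// addr_ge0 ?expR_ge0.
Qed.

(** Moves the dependence on x from the domain into the integrand, so that integrals for different
    pairs of points can be summed. The case x = 0 is separate because the substitution rule needs
    continuity at the left endpoint. *)
Lemma upper_gamma_shift (R : realType) (s x : R) : 0 < s -> 0 <= x ->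
  (\int[@mu R]_(t in `[x, +oo[) (t `^ (s - 1) * expR (- t))%:E =
   \int[@mu R]_(t in `[0%R, +oo[) ((t + x) `^ (s - 1) * expR (- (t + x)))%:E)%E.
Proof.
move=> s0; rewrite le_eqVlt => /predU1P[<-|x0].
  by apply: eq_integral => t _; rewrite addr0.
have dF : (fun t : R => t + x)^`()%classic = cst 1.
  by apply/funext => t; rewrite derive1E derive_val addr0.
have cA : continuous (fun t : R => t + x).
  by move=> t; apply: cvgD; [exact: cvg_id|exact: cvg_cst].
have := @increasing_ge0_integration_by_substitutiony R (fun t => t + x)
  (fun t => t `^ (s - 1) * expR (- t)) 0; rewrite add0r => ->.
- apply: eq_integral => t _; rewrite dF.
  by change (((t + x) `^ (s - 1) * expR (- (t + x)) * 1)%:E =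
    ((t + x) `^ (s - 1) * expR (- (t + x)))%:E); rewrite mulr1.
- by move=> a b _ _ ab; rewrite ltrD2r.
- by rewrite dF => t _; exact: cst_continuous.
- by rewrite dF; exact: is_cvg_cst.
- by rewrite dF; exact: is_cvg_cst.
- by split; [move=> t _; apply: ex_derive | apply: cvg_at_right_filter; exact: cA].
- exact: cvg_addrr.
- apply: continuous_in_subspaceT => t; rewrite inE/= in_itv/= andbT => xt.
  apply: cvgM; first by apply: continuous_powR; exact: lt_le_trans xt.
  by apply: continuous_comp; [exact: continuousN|exact: continuous_expR].
- by move=> t _; rewrite mulr_ge0 ?powR_ge0 ?expR_ge0.
Qed.

Lemma eucl_normN (R : realType) (d : nat) (h : 'rV[R]_d) : eucl_norm (- h) = eucl_norm h.
Proof. by rewrite /eucl_norm; under eq_bigr do rewrite mxE sqrrN. Qed.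

Lemma Qgamma_covariance (R : realType) (d : nat) (s b : R) : 0 < s < 1 -> 0 < b ->
  covariance_kernel (fun h : 'rV[R]_d => Qgamma s (eucl_norm h ^+ 2 / b ^+ 2)).
Proof.
move=> /andP[s0 s1] b0; split=> [h|n x w].
  by rewrite eucl_normN.
have k0 : 0 <= (b ^+ 2)^-1 by rewrite invr_ge0 exprn_ge0// ltW.
pose q i j := (b ^+ 2)^-1 * eucl_norm (x i - x j) ^+ 2.
have q0 i j : 0 <= q i j by rewrite mulr_ge0// exprn_ge0// sqrtr_ge0.
have i0 i j : (@mu R).-integrable `[0, +oo[
    (EFin \o (fun t => (t + q i j) `^ (s - 1) * expR (- (t + q i j)))).
  have mf D : measurable_fun D
      (EFin \o (fun t : R => (t + q i j) `^ (s - 1) * expR (- (t + q i j)))).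
    apply/measurable_EFinP; apply: measurable_funTS.
    apply: (@measurableT_comp _ _ _ _ _ _ (fun t : R => t `^ (s - 1) * expR (- t))).
      exact: measurable_powR_expR.
    exact: measurable_funD.
  apply/integrableP; split; first exact: mf.
  under eq_integral do rewrite /= ger0_norm ?mulr_ge0 ?powR_ge0 ?expR_ge0//.
  rewrite -upper_gamma_shift//.
  have /integrableP[_] := @integrableS _ _ R mu `[0, +oo[ `[q i j, +oo[ _ ltac:(done) ltac:(done)
     ltac:(move=> t /=; rewrite !in_itv/= !andbT; exact: le_trans) (integrable_gamma s0).
  by under eq_integral do rewrite /= ger0_norm ?mulr_ge0 ?powR_ge0 ?expR_ge0//.
(* The open half-line discards t = 0, where [t + q i j] vanishes on the diagonal and
   [quad_form_powR] does not apply. *)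
have i1 i j : (@mu R).-integrable `]0, +oo[
    (EFin \o (fun t => (t + q i j) `^ (s - 1) * expR (- (t + q i j)))).
  by apply: integrableS (i0 i j) => //; move=> t /=; rewrite !in_itv/= !andbT; exact: ltW.
have -> : \sum_(i < n) \sum_(j < n) w i * w j * Qgamma s (eucl_norm (x i - x j) ^+ 2 / b ^+ 2) =
   (Gamma s)^-1 * \sum_(i < n) \sum_(j < n) w i * w j *
     \int[@mu R]_(t in `]0, +oo[) ((t + q i j) `^ (s - 1) * expR (- (t + q i j))).
  rewrite mulr_sumr; apply: eq_bigr => i _; rewrite mulr_sumr; apply: eq_bigr => j _.
  rewrite /Qgamma mulrCA; congr (_ * (_ * _)).
  rewrite (Rintegral_itv_obnd_cbnd (i1 i j)) /Rintegral -upper_gamma_shift//.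
  by rewrite /q mulrC.
rewrite mulr_ge0 ?invr_ge0 ?(ltW (Gamma_gt0 s0))//.
apply: quad_form_integral => // t /=; rewrite in_itv/= andbT => t0.
have := @quad_form_powR R d n x w (b ^+ 2)^-1 (1 - s) t k0 ltac:(lra) t0.
have := expR_ge0 (- t) => e0 /(mulr_ge0 e0); congr (0 <= _).
rewrite mulr_sumr; apply: eq_bigr => i _; rewrite mulr_sumr; apply: eq_bigr => j _.
have -> : expR (- (t + q i j)) = expR (- t) * expR (- q i j) by rewrite -expRD -opprD.
have -> : s - 1 = - (1 - s) by ring.
by rewrite [t + q i j]addrC /q; ring.
Qed.

(** * Incomplete beta integrals *)

(** Weighted AM-GM with weight 1/c at u = 1 - c z reads [(1 - c z)^(1/c) <= 1 - z]; raising to the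
    power c gives the claim when u is positive. *)
Lemma bernoulli_powR (R : realType) (c z : R) : 1 <= c -> 0 <= z <= 1 ->
  1 - c * z <= (1 - z) `^ c.
Proof.
move=> c1 /andP[z0 z1]; have c0 : 0 < c by lra.
have [u0|u0] := leP (1 - c * z) 0; first exact: le_trans (powR_ge0 _ _).
have ci : c^-1 <= 1 by rewrite invf_le1.
have := @weighted_AM_GM1 R c^-1 (1 - c * z).
rewrite ci andbT invr_ge0 (ltW c0) => /(_ isT u0).
have -> : c^-1 * (1 - c * z) + (1 - c^-1) = 1 - z by field; exact: lt0r_neq0.
move=> H; have := @ge0_ler_powR R c (ltW c0) _ _ _ _ H.
rewrite -powRrM mulVf ?lt0r_neq0// powRr1 ?(ltW u0)//; apply.
- by rewrite nnegrE powR_ge0.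
- by rewrite nnegrE; lra.
Qed.

(** With y = s/c, [(1 - y)^(c-1) <= e^(y-s)], which exceeds [e^(-s)] by at most [y e^(y-s)]; c >= 2
    gives y <= s/2, hence the halved decay rate. For s >= c the power is 0. *)
Lemma powR_approx_upper (R : realType) (c s : R) : 2 <= c -> 0 <= s ->
  posp (1 - s / c) `^ (c - 1) - expR (- s) <= s / c * expR (- (s / 2)).
Proof.
move=> c2 s0; have c0 : 0 < c by lra.
have y0 : 0 <= s / c by rewrite divr_ge0// ltW.
have [sc|sc] := leP c s.
  have -> : posp (1 - s / c) = 0.
    by apply/max_idPr; rewrite subr_le0 ler_pdivlMr// mul1r.
  rewrite powR0; last by rewrite subr_eq0; apply/eqP; lra.
  rewrite sub0r (@le_trans _ _ 0)// ?oppr_le0 ?expR_ge0//.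
  by rewrite mulr_ge0 ?expR_ge0.
have y1 : s / c < 1 by rewrite ltr_pdivrMr// mul1r.
have -> : posp (1 - s / c) = 1 - s / c by apply/max_idPl; lra.
set y := s / c in y0 y1 *.
have sE : s = c * y by rewrite /y; field; exact: lt0r_neq0.
have H1 : (1 - y) `^ (c - 1) <= expR (y - s).
  rewrite (@le_trans _ _ (expR (- y) `^ (c - 1)))//.
    apply: ge0_ler_powR; rewrite ?nnegrE ?expR_ge0//; [lra|lra|].
    by have := expR_ge1Dx (- y); lra.
  by rewrite -expRM sE ler_expR; lra.
have H2 : expR (y - s) - expR (- s) <= y * expR (y - s).
  have -> : expR (- s) = expR (- y) * expR (y - s) by rewrite -expRD; congr expR; ring.
  have := ler_wpM2r (expR_ge0 (y - s)) (expR_ge1Dx (- y)); lra.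
have H3 : expR (y - s) <= expR (- (s / 2)).
  rewrite ler_expR sE; have := @ler_wpM2r _ y y0 2 c c2; lra.
have := ler_wpM2l y0 H3; lra.
Qed.

(** With y = s/c, [(1 - y) e^y >= 1 - y^2], and Bernoulli turns the c-th power into
    [1 - c y^2 = 1 - s^2/c]. For s >= c the factor [s^2/c] is already at least 1. *)
Lemma powR_approx_lower (R : realType) (c s : R) : 2 <= c -> 0 <= s ->
  expR (- s) - posp (1 - s / c) `^ (c - 1) <= s ^+ 2 / c * expR (- s).
Proof.
move=> c2 s0; have c0 : 0 < c by lra.
have y0 : 0 <= s / c by rewrite divr_ge0// ltW.
have [sc|sc] := leP c s.
  have : 1 <= s ^+ 2 / c.
    by rewrite ler_pdivlMr// mul1r expr2 (le_trans sc)// ler_peMl//; lra.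
  move=> /(ler_wpM2r (expR_ge0 (- s))).
  have := powR_ge0 (posp (1 - s / c)) (c - 1); lra.
have y1 : s / c < 1 by rewrite ltr_pdivrMr// mul1r.
have -> : posp (1 - s / c) = 1 - s / c by apply/max_idPl; lra.
set y := s / c in y0 y1 *.
have sE : s = c * y by rewrite /y; field; exact: lt0r_neq0.
have H1 : (1 - y) `^ c <= (1 - y) `^ (c - 1) by apply: ger_powR; lra.
have H2 : 1 - y ^+ 2 <= (1 - y) * expR y.
  have Y : 0 <= 1 - y by lra.
  by have := ler_wpM2l Y (expR_ge1Dx y); rewrite expr2; lra.
have yy : 0 <= y ^+ 2 <= 1 by rewrite exprn_ge0//= expr_le1// ltW.
have H3 : 1 - c * y ^+ 2 <= (1 - y) `^ c * expR s.
  apply: (le_trans (bernoulli_powR _ yy)); first by lra.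
  have -> : expR s = expR y `^ c by rewrite -expRM mulrC -sE.
  rewrite -powRM ?expR_ge0//; last by lra.
  apply: ge0_ler_powR H2; rewrite ?nnegrE; [lra|lra|].
  by rewrite mulr_ge0 ?expR_ge0//; lra.
have -> : s ^+ 2 / c = c * y ^+ 2 by rewrite sE; field; exact: lt0r_neq0.
have := ler_wpM2r (expR_ge0 (- s)) H3.
rewrite -[X in _ <= X]mulrA expRxMexpNx_1 mulr1; lra.
Qed.

(** The positive part makes the integrand vanish beyond c when c > 1, so integrals up to c are
    written over a half-line, as for the gamma integrand. *)
Definition beta_integrand (R : realType) (s c t : R) : R :=
  t `^ (s - 1) * posp (1 - t / c) `^ (c - 1).

(** Both one-sided errors carry a factor t, which turns [t^(s-1)] into [t^s <= 1 + t]. What remains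
    is [(1 + t)^2 e^(-t/2) / c], and 64 comes from squaring [(1 + t)/8 <= e^(t/8)]. *)
Lemma beta_integrand_approx (R : realType) (s c t : R) : 0 < s < 1 -> 2 <= c -> 0 < t ->
  `|beta_integrand s c t - t `^ (s - 1) * expR (- t)| <= 64 / c * expR (- 4^-1 * t).
Proof.
move=> /andP[s0 s1] c2 t0; have c0 : 0 < c by lra.
have t0' := ltW t0; have ci : 0 < c^-1 by rewrite invr_gt0.
rewrite /beta_integrand -mulrBr normrM ger0_norm ?powR_ge0//.
set v := posp _ `^ _.
have H : `|v - expR (- t)| <= t * (1 + t) / c * expR (- (t / 2)).
  have U := @powR_approx_upper R c t c2 t0'; have L := @powR_approx_lower R c t c2 t0'.
  rewrite -/v in U L.
  have e12 : expR (- t) <= expR (- (t / 2)) by rewrite ler_expR; lra.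
  have tc : 0 <= t / c by rewrite divr_ge0// ltW.
  have ttc : 0 <= t ^+ 2 / c by rewrite divr_ge0 ?exprn_ge0// ltW.
  have A := mulr_ge0 tc (expR_ge0 (- (t / 2))).
  have B := mulr_ge0 ttc (expR_ge0 (- (t / 2))).
  have C := ler_wpM2l ttc e12.
  have -> : t * (1 + t) / c * expR (- (t / 2)) =
    t / c * expR (- (t / 2)) + t ^+ 2 / c * expR (- (t / 2)) by ring.
  by rewrite ler_norml; apply/andP; split; lra.
apply: (le_trans (ler_wpM2l (powR_ge0 t (s - 1)) H)).
have -> : t `^ (s - 1) * (t * (1 + t) / c * expR (- (t / 2))) =
    t `^ s * (1 + t) * (c^-1 * expR (- (t / 2))).
  by rewrite (powR_split1 s t0); ring.
have P : 0 <= c^-1 * expR (- (t / 2)) by rewrite mulr_ge0 ?expR_ge0// ltW.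
have T : t `^ s * (1 + t) <= 64 * expR (t / 4).
  have ts : t `^ s <= 1 + t by apply: powR_le1D => //; lra.
  have e8 : (1 + t) / 8 <= expR (t / 8) by have := expR_ge1Dx (t / 8); lra.
  have -> : expR (t / 4) = expR (t / 8) * expR (t / 8) by rewrite -expRD; congr expR; lra.
  have t8 : 0 <= (1 + t) / 8 by lra.
  have := ler_pM t8 t8 e8 e8.
  have t1 : 0 <= 1 + t by lra.
  have := ler_wpM2r t1 ts; lra.
apply: (le_trans (ler_wpM2r P T)).
rewrite le_eqVlt; apply/orP; left; apply/eqP.
have -> : expR (- 4^-1 * t) = expR (t / 4) * expR (- (t / 2)) by rewrite -expRD; congr expR; lra.
by ring.
Qed.

Lemma measurable_posp_powR (R : realType) (c q : R) (D : set R) :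
  measurable_fun D (fun t : R => posp (1 - t / c) `^ q).
Proof.
apply: measurable_funTS.
apply: (@measurableT_comp _ _ _ _ _ _ (fun t : R => t `^ q)); first exact: measurable_powR.
apply: measurable_maxr => //; apply: measurable_funB => //; exact: measurable_funM.
Qed.

(** Dominated by the gamma integrand plus the error bound of [beta_integrand_approx]. *)
Lemma integrable_beta_integrand (R : realType) (s c : R) : 0 < s < 1 -> 2 <= c ->
  (@mu R).-integrable `]0, +oo[ (EFin \o beta_integrand s c).
Proof.
move=> s01 c2; have s0 : 0 < s by lra.
have sub : `]0, +oo[%classic `<=` (`[0, +oo[%classic : set R).
  by move=> t /=; rewrite !in_itv/= !andbT; exact: ltW.
have i1 : (@mu R).-integrable `]0, +oo[ (EFin \o (fun t => t `^ (s - 1) * expR (- t))).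
  by apply: integrableS (integrable_gamma s0).
have i2 : (@mu R).-integrable `]0, +oo[ (EFin \o (fun t => 64 / c * expR (- 4^-1 * t))).
  have q0 : 0 < 4^-1 :> R by rewrite invr_gt0.
  have j : (@mu R).-integrable `]0, +oo[ (EFin \o (fun t => expR (- 4^-1 * t))).
    by apply: integrableS (integrable_expRM 0 q0).
  by apply: (integrableZl _ _ j).
apply: (le_integrable _ _ _ (integrableD _ i1 i2)) => //.
  apply/measurable_EFinP; apply: measurable_funM; last exact: measurable_posp_powR.
  by apply: measurable_funTS; exact: measurable_powR.
move=> t /=; rewrite in_itv/= andbT => t0; rewrite lee_fin.
have := beta_integrand_approx s01 c2 t0; rewrite ler_norml => /andP[_ H].
have b0 : 0 <= beta_integrand s c t by rewrite mulr_ge0 ?powR_ge0.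
rewrite !ger0_norm//; first by lra.
by apply: le_trans b0 _; lra.
Qed.

(** * The binomial series with rising factorials *)

Lemma pochhammerS (R : realType) (p : R) (n : nat) :
  pochhammer p n.+1 = pochhammer p n * (p + n%:R).
Proof. by rewrite /pochhammer big_ord_recr. Qed.

Lemma pochhammer_ge0 (R : realType) (p : R) (n : nat) : 0 <= p -> 0 <= pochhammer p n.
Proof. by move=> p0; apply: prodr_ge0 => i _; rewrite addr_ge0. Qed.

Lemma pochhammer_gt0 (R : realType) (p : R) (n : nat) : 0 < p -> 0 < pochhammer p n.
Proof. by move=> p0; apply: prodr_gt0 => i _; rewrite ltr_wpDr. Qed.

Lemma pochhammer_shift (R : realType) (p : R) (n : nat) :
  pochhammer p n * (p + n%:R) = p * pochhammer (p + 1) n.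
Proof.
elim: n => [|n IH]; first by rewrite /pochhammer !big_ord0 addr0 mulrC.
rewrite !pochhammerS [in LHS]IH -[n.+1]addn1 natrD -!mulrA.
by congr (_ * (_ * _)); ring.
Qed.

(** The Taylor coefficient of [(1 - t)^(-p)] at 0. *)
Definition binom_coef (R : realType) (p : R) (n : nat) : R := pochhammer p n / n`!%:R.

Lemma binom_coef0 (R : realType) (p : R) : binom_coef p 0 = 1.
Proof. by rewrite /binom_coef /pochhammer big_ord0 fact0 divr1. Qed.

Lemma binom_coefS (R : realType) (p : R) (n : nat) :
  n.+1%:R * binom_coef p n.+1 = (p + n%:R) * binom_coef p n.
Proof.
rewrite /binom_coef pochhammerS factS natrM invfM.
have n0 : n.+1%:R != 0 :> R by rewrite pnatr_eq0.
by rewrite mulrCA [n.+1%:R * _]mulrA mulfV// mul1r; ring.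
Qed.

Lemma binom_coef_ge0 (R : realType) (p : R) (n : nat) : 0 <= p -> 0 <= binom_coef p n.
Proof. by move=> p0; rewrite divr_ge0// pochhammer_ge0. Qed.

Lemma binom_coef_le1 (R : realType) (p : R) (n : nat) : 0 <= p <= 1 -> binom_coef p n <= 1.
Proof.
move=> /andP[p0 p1]; elim: n => [|n IH]; first by rewrite binom_coef0.
rewrite -(@ler_pM2l _ n.+1%:R)// binom_coefS mulr1 -[leRHS]mulr1.
by rewrite ler_pM ?binom_coef_ge0 ?addr_ge0// -natr1 addrC lerD2l.
Qed.

Definition binom_sum (R : realType) (p : R) (N : nat) (t : R) : R :=
  \sum_(0 <= n < N) binom_coef p n * t ^+ n.

Lemma is_derive_binom_sum (R : realType) (p : R) (N : nat) (t : R) :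
  is_derive t 1 (binom_sum p N) (\sum_(0 <= n < N) n%:R * binom_coef p n * t ^+ n.-1).
Proof.
elim: N => [|N IH].
  have -> : binom_sum p 0 = cst 0 by apply/funext => x; rewrite /binom_sum big_nil.
  by rewrite big_nil; exact: is_derive_cst.
have -> : binom_sum p N.+1 = binom_sum p N \+ (fun t => binom_coef p N * t ^+ N).
  by apply/funext => x; rewrite /binom_sum big_nat_recr.
rewrite big_nat_recr//=; apply: is_deriveD.
case: N {IH} => [|N].
  have -> : (fun t : R => binom_coef p 0 * t ^+ 0) = cst (binom_coef p 0).
    by apply/funext => x; rewrite expr0 mulr1.
  by apply: (is_derive_eq (is_derive_cst _ _ _)); rewrite !mul0r.
have d := is_deriveZ (binom_coef p N.+1) (is_deriveX N.+1 (is_derive_id t (1 : R))).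
have -> : (fun t : R => binom_coef p N.+1 * t ^+ N.+1) = binom_coef p N.+1 *: (id ^+ N.+1).
  by apply/funext => x; rewrite !fctE.
by apply: (is_derive_eq d); rewrite /GRing.scale/=; ring.
Qed.

(* Truncation of the equation (1 - t) S' = p S of the full series. *)
Lemma binom_sum_ode (R : realType) (p : R) (N : nat) (t : R) :
  (1 - t) * (\sum_(0 <= n < N) n%:R * binom_coef p n * t ^+ n.-1) =
  p * binom_sum p N t - N%:R * binom_coef p N * t ^+ N.-1.
Proof.
elim: N => [|N IH]; first by rewrite /binom_sum !big_nil !mul0r !mulr0 subrr.
rewrite /binom_sum !big_nat_recr//= mulrDr IH -/(binom_sum p N t) binom_coefS.
set X := N%:R * binom_coef p N * t ^+ N.-1.
have E : N%:R * binom_coef p N * t ^+ N = t * X.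
  by rewrite /X; case: N {IH X} => [|N]; [rewrite !mul0r mulr0 | rewrite /= exprS; ring].
have -> : (p + N%:R) * binom_coef p N * t ^+ N = p * (binom_coef p N * t ^+ N) + t * X.
  by rewrite -E; ring.
by ring.
Qed.

(** By the truncated differential equation, the derivative of [(1 - x)^p S(x)] reduces to the
    boundary term [dg]; the mean value theorem from x = 0, where the product is 1, then bounds the
    deviation. The coefficients are at most 1, and [(1 - z)^(p-1) <= (1 - t)^(-1)] for z < t. *)
Lemma binom_sum_error (R : realType) (p : R) (N : nat) (t : R) : 0 < p <= 1 -> 0 < t < 1 ->
  `|(1 - t) `^ p * binom_sum p N.+1 t - 1| <= (1 - t)^-1 * (N.+1%:R * t ^+ N).
Proof.
move=> /andP[p0 p1] /andP[t0 t1].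
pose g x : R := (1 - x) `^ p * binom_sum p N.+1 x.
pose dg x : R := - ((1 - x) `^ (p - 1) * (N.+1%:R * binom_coef p N.+1 * x ^+ N)).
have dgE (x : R) : x < 1 -> is_derive x 1 g (dg x).
  move=> x1; have x1' : 0 < 1 - x by lra.
  have d1 : is_derive x 1 (fun x => (1 - x) `^ p) (- (p * (1 - x) `^ (p - 1))).
    have dp := is_derive1_powR p x1'.
    have d0 : is_derive x 1 (fun x : R => 1 - x) (- 1) by apply: is_derive_eq; ring.
    have := @is_derive1_comp R (@powR R ^~ p) (fun x => 1 - x) x _ _ dp d0.
    by rewrite mulrN1.
  have d2 := is_derive_binom_sum p N.+1 x.
  apply: (is_derive_eq (is_deriveM d1 d2)).
  rewrite /GRing.scale/= (powR_split1 p x1') /dg.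
  have := binom_sum_ode p N.+1 x; rewrite [N.+1.-1]/=.
  set D := \sum_(0 <= n < N.+1) _; set S := binom_sum _ _ _ => O.
  have -> : (1 - x) * (1 - x) `^ (p - 1) * D = (1 - x) `^ (p - 1) * ((1 - x) * D) by ring.
  by rewrite O; ring.
have cg : {within `[0, t], continuous g}.
  apply: continuous_in_subspaceT => x; rewrite inE/= in_itv/= => /andP[_ xt].
  apply/differentiable_continuous/derivable1_diffP; apply: ex_derive.
  by apply: dgE; exact: le_lt_trans t1.
have [x||z] := @MVT R g dg 0 t t0.
  by rewrite in_itv/= => /andP[_ xt]; apply: dgE; exact: lt_trans t1.
  exact: cg.
rewrite in_itv/= => /andP[z0 zt]; rewrite subr0.
have g0 : g 0 = 1.
  rewrite /g subr0 powR1 mul1r /binom_sum big_nat_recl//= binom_coef0 expr0 mulr1.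
  by rewrite big1 ?addr0// => i _; rewrite expr0n mulr0.
rewrite g0 -/(g t) => ->.
have z1 : 0 < 1 - z by lra.
have Q0 : 0 <= N.+1%:R * binom_coef p N.+1 * z ^+ N.
  apply: mulr_ge0; last by apply: exprn_ge0; exact: ltW.
  by apply: mulr_ge0 => //; apply: binom_coef_ge0; exact: ltW.
rewrite normrM (gtr0_norm t0) /dg normrN ger0_norm; last first.
  by rewrite mulr_ge0 ?powR_ge0.
have P1 : (1 - z) `^ (p - 1) <= (1 - t)^-1.
  apply: (@le_trans _ _ (1 - z)^-1).
    by rewrite -(powR_inv1 (ltW z1)); apply: ger_powR; lra.
  by rewrite lef_pV2 ?posrE//; lra.
rewrite -[leRHS]mulr1 ler_pM ?(ltW t0) ?(ltW t1)//.
  by rewrite mulr_ge0 ?powR_ge0.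
rewrite ler_pM ?powR_ge0//.
rewrite -mulrA ler_wpM2l// -[leRHS]mul1r.
rewrite ler_pM ?exprn_ge0 ?binom_coef_ge0 ?binom_coef_le1 ?(ltW z0) ?(ltW p0)//.
by apply: lerXn2r; rewrite ?nnegrE; exact: ltW.
Qed.

(** Writing [t^N = e^(-L N)] with L = - ln t > 0 reduces the claim to [x e^(-x)] tending to 0 along
    x = L N. *)
Lemma cvg_natM_expr (R : realType) (t : R) : 0 < t < 1 ->
  N%:R * t ^+ N @[N --> \oo] --> (0 : R).
Proof.
move=> /andP[t0 t1]; pose L := - ln t.
have L0 : 0 < L by rewrite oppr_gt0 ln_lt0// t0 t1.
have H : (L * N%:R) `^ 1 * expR (- (L * N%:R)) @[N --> \oo] --> (0 : R).
  apply: (@cvg_comp _ _ _ (fun N : nat => N%:R) (fun x => (L * x) `^ 1 * expR (- (L * x))) _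
    (pinfty_nbhs R)); first exact: cvgr_idn.
  apply: (@cvg_comp _ _ _ (fun x => L * x) (fun x => x `^ 1 * expR (- x)) _ (pinfty_nbhs R)).
    exact: gt0_cvgMry.
  exact: cvg_powR_expR_pinfty.
have {}H : L^-1 * ((L * N%:R) `^ 1 * expR (- (L * N%:R))) @[N --> \oo] --> L^-1 * 0.
  exact: cvgMr.
move: H; rewrite mulr0.
apply: cvg_trans; apply: near_eq_cvg; apply: nearW => N /=.
have LN : 0 <= L * N%:R by rewrite mulr_ge0// ltW.
have -> : - (L * N%:R) = N%:R * ln t by rewrite /L; ring.
by rewrite powRr1// expRM_natl lnK ?posrE// -mulrA mulKf// lt0r_neq0.
Qed.

Lemma binomial_series (R : realType) (p t : R) : 0 < p <= 1 -> 0 < t < 1 ->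
  series (fun n => binom_coef p n * t ^+ n) @ \oo --> (1 - t) `^ (- p).
Proof.
move=> p01 t01; have /andP[t0 t1] := t01; have t1' : 0 < 1 - t by lra.
rewrite -cvg_shiftS.
have E : (1 - t) `^ p * binom_sum p N.+1 t @[N --> \oo] --> (1 : R).
  apply/cvgrPdist_le => e e0.
  have c0 : (1 - t)^-1 * (t^-1 * (N.+1%:R * t ^+ N.+1)) @[N --> \oo] --> (0 : R).
    rewrite -[X in _ --> X](mulr0 (1 - t)^-1); apply: cvgMr.
    rewrite -[X in _ --> X](mulr0 t^-1); apply: cvgMr.
    by have := cvg_natM_expr t01; rewrite -cvg_shiftS.
  have /cvgrPdist_le /(_ e e0) := c0; apply: filterS => N.
  rewrite sub0r normrN => H; rewrite distrC (le_trans (binom_sum_error N p01 t01))//.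
  have -> : (1 - t)^-1 * (N.+1%:R * t ^+ N) = (1 - t)^-1 * (t^-1 * (N.+1%:R * t ^+ N.+1)).
    by congr (_ * _); rewrite exprS mulrCA mulKf// lt0r_neq0.
  exact: le_trans (ler_norm _) H.
have {}E : (1 - t) `^ (- p) * ((1 - t) `^ p * binom_sum p N.+1 t) @[N --> \oo] -->
    (1 - t) `^ (- p) * 1 by exact: cvgMr.
move: E; rewrite mulr1.
apply: cvg_trans; apply: near_eq_cvg; apply: nearW => N /=.
by rewrite mulrA -powRD ?(gt_eqF t1') ?implybT// addNr powRr0 mul1r.
Qed.

Lemma cvg_series_nneseries (R : realType) (u : nat -> R) (l : R) :
  (forall n, 0 <= u n) -> (\sum_(n <oo) (u n)%:E = l%:E)%E -> series u @ \oo --> l.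
Proof.
move=> u0 ul.
have c : (\sum_(0 <= n < N) (u n)%:E)%E @[N --> \oo] --> l%:E.
  by rewrite -ul; apply: is_cvg_nneseries => n _ _; rewrite lee_fin.
have -> : series u = fun N => fine (\sum_(0 <= n < N) (u n)%:E)%E.
  by apply/funext => N; rewrite sumEFin.
exact: (fine_cvg c).
Qed.

Lemma nneseries_cvg_series (R : realType) (u : nat -> R) (l : R) :
  series u @ \oo --> l -> (\sum_(n <oo) (u n)%:E = l%:E)%E.
Proof.
move=> ul; apply: cvg_lim => //.
have -> : (fun N => \sum_(0 <= n < N) (u n)%:E)%E = EFin \o series u.
  by apply/funext => N; rewrite sumEFin.
by apply: cvg_EFin => //; exact: nearW.
Qed.

(** * Termwise integration of the binomial series *)

Lemma continuous_posp (R : realType) : continuous (@posp R).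
Proof.
move=> x; rewrite /posp; apply: (@continuous_max _ _ id (cst 0)).
  exact: cvg_id.
exact: cvg_cst.
Qed.

Lemma integral_posp_powR (R : realType) (c m x : R) : 0 < c -> 1 < m -> 0 <= x ->
  (\int[@mu R]_(t in `[x, +oo[) (posp (1 - t / c) `^ (m - 1))%:E =
   (c / m * posp (1 - x / c) `^ m)%:E)%E.
Proof.
move=> c0 m1 x0.
pose f t : R := posp (1 - t / c) `^ (m - 1).
have f0 (t : R) : 0 <= f t by exact: powR_ge0.
have big (t : R) : c <= t -> posp (1 - t / c) = 0.
  by move=> ct; apply/max_idPr; rewrite subr_le0 ler_pdivlMr// mul1r.
have fbig (t : R) : c <= t -> f t = 0.
  by move=> ct; rewrite /f big// powR0//; apply/eqP; lra.
have small (t : R) : t < c -> posp (1 - t / c) = 1 - t / c /\ 0 < 1 - t / c.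
  move=> tc; have : t / c < 1 by rewrite ltr_pdivrMr// mul1r.
  by move=> tc1; split; [apply/max_idPl; lra | lra].
have mf D : measurable_fun D f by exact: measurable_posp_powR.
have [cx|xc] := leP c x.
  rewrite big// powR0; last by apply/eqP; lra.
  rewrite mulr0; apply: integral0_eq => t; rewrite /= in_itv/= andbT => xt.
  by rewrite -/(f t) fbig//; exact: le_trans xt.
rewrite (@itv_bndbnd_setU _ _ _ (BRight c)) ?bnd_simp//; last exact: ltW.
rewrite ge0_integral_setU//=; first last.
- apply/disj_setPS => t [] /=; rewrite !in_itv/= => /andP[_ t1]; rewrite andbT.
  by rewrite ltNge t1.
- by move=> t _; rewrite lee_fin f0.
- by apply/measurable_EFinP; exact: mf.
rewrite [X in (_ + X)%E]integral0_eq ?adde0; last first.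
  by move=> t; rewrite /= in_itv/= andbT => ct; rewrite -/(f t) fbig// ltW.
(* Continuity is needed up to the kink t = c, where the base of the power is 0; there it relies on q
   > 0. *)
have cpos (q t : R) : 0 < q -> {for t, continuous (fun t : R => posp (1 - t / c) `^ q)}.
  move=> q0.
  have cl : {for t, continuous (fun t : R => 1 - t / c)}.
    by apply: cvgB; [exact: cvg_cst|apply: cvgM; [exact: cvg_id|exact: cvg_cst]].
  have cp : {for t, continuous (fun t : R => posp (1 - t / c))}.
    exact: (continuous_comp cl (@continuous_posp R _)).
  have [ct|tc] := ltP t c; last first.
    apply/cvgrPdist_lt => e e0; rewrite big// powR0 ?gt_eqF//.
    (* If the base is below [e^(1/q)], its q-th power is below e. *)
    have e1 : 0 < e `^ q^-1 by exact: powR_gt0.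
    move/cvgrPdist_lt : cp => /(_ _ e1); apply: filterS => y /=.
    rewrite big// !sub0r !normrN.
    have p0 : 0 <= posp (1 - y / c) by rewrite le_max lexx orbT.
    rewrite ger0_norm// ger0_norm ?powR_ge0// => H.
    have := @gt0_ltr_powR _ q q0 _ _ _ _ H; rewrite -powRrM mulVf ?gt_eqF// powRr1 ?ltW//.
    by apply; rewrite nnegrE ?powR_ge0.
  have [E P] := small _ ct.
  have cq : {for posp (1 - t / c), continuous (@powR R ^~ q)}.
    by apply: continuous_powR; rewrite E.
  exact: (continuous_comp cp cq).
pose F t : R := - (c / m * posp (1 - t / c) `^ m).
have dF (t : R) : t < c -> is_derive t 1 F (f t).
  move=> tc; have [E P] := small _ tc.
  have dl : is_derive t 1 (fun t : R => 1 - t / c) (- c^-1).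
    by apply: is_derive_eq; rewrite /GRing.scale/=; ring.
  have dp := is_derive1_powR m P.
  have d := @is_derive1_comp R (@powR R ^~ m) (fun t => 1 - t / c) t _ _ dp dl.
  have d' := is_deriveZ (- (c / m)) d.
  have -> : f t = - (c / m) *: (m * (1 - t / c) `^ (m - 1) * - c^-1).
    by rewrite /f E /GRing.scale/=; field; lra.
  apply: (near_eq_is_derive _ d').
  near=> y; have yc : y < c by near: y; exact: lt_nbhsl.
  by rewrite /F (small _ yc).1 -[RHS]mulNr.
rewrite (@continuous_FTC2 _ f F)//.
- by rewrite -EFinB /F (big c)// powR0 ?gt_eqF ?mulr0//; [congr EFin; ring|lra].
- by apply: continuous_subspaceT => t; apply: cpos; lra.
- have cF t : {for t, continuous F}.
    by apply: cvgN; apply: cvgMr; apply: cpos; lra.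
  split.
  + by move=> t; rewrite in_itv/= => /andP[_ tc]; case: (dF t tc).
  + by apply: cvg_at_right_filter; exact: cF.
  + by apply: cvg_at_left_filter; exact: cF.
- move=> t; rewrite in_itv/= => /andP[_ tc].
  by rewrite derive1E; apply: derive_val; exact: dF.
Unshelve. all: by end_near. Qed.

(** Nonnegativity of the terms makes the interchange valid down to x = 0. The open left end keeps 1
    - t/c < 1, inside the disc of the binomial series; for t >= c all terms vanish. *)
Lemma beta_integral_series (R : realType) (s c x : R) : 0 < s < 1 -> 1 < c -> 0 <= x ->
  (\int[@mu R]_(t in `]x, +oo[) (beta_integrand s c t)%:E =
   \sum_(n <oo) (c `^ (s - 1) * (binom_coef (1 - s) n * (c / (c + n%:R))) *
      posp (1 - x / c) `^ (c + n%:R))%:E)%E.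
Proof.
move=> /andP[s0 s1] c1 x0; have c0 : 0 < c by lra.
pose f n t : R := c `^ (s - 1) * binom_coef (1 - s) n * posp (1 - t / c) `^ (c + n%:R - 1).
have b0 n : 0 <= c `^ (s - 1) * binom_coef (1 - s) n.
  by rewrite mulr_ge0 ?powR_ge0 ?binom_coef_ge0//; lra.
have f0 n t : 0 <= f n t by rewrite mulr_ge0 ?powR_ge0.
have mf n D : measurable_fun D (f n).
  by apply: measurable_funM => //; exact: measurable_posp_powR.
have -> : (\int[@mu R]_(t in `]x, +oo[) (beta_integrand s c t)%:E =
    \int[@mu R]_(t in `]x, +oo[) (\sum_(n <oo) (f n t)%:E))%E.
  apply: eq_integral => t; rewrite inE/= in_itv/= andbT => xt.
  have t0 : 0 < t by exact: le_lt_trans xt.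
  apply/esym/nneseries_cvg_series.
  have [ct|tc] := leP c t.
    have big : posp (1 - t / c) = 0.
      by apply/max_idPr; rewrite subr_le0 ler_pdivlMr// mul1r.
    rewrite /beta_integrand big powR0; last by apply/eqP; lra.
    rewrite mulr0 (_ : series _ = cst 0); first exact: cvg_cst.
    apply/funext => N; rewrite /series/= big1// => n _.
    rewrite /f big powR0 ?mulr0//; have := ler0n R n; move=> ?; apply/eqP; lra.
  have tc1 : t / c < 1 by rewrite ltr_pdivrMr// mul1r.
  have tc0 : 0 < t / c by rewrite divr_gt0.
  have E : posp (1 - t / c) = 1 - t / c by apply/max_idPl; lra.
  have P : 0 < 1 - t / c by lra.
  have B := @binomial_series R (1 - s) (1 - t / c) ltac:(lra) ltac:(lra).
  have {}B : (c `^ (s - 1) * (1 - t / c) `^ (c - 1)) *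
      series (fun n => binom_coef (1 - s) n * (1 - t / c) ^+ n) N @[N --> \oo] -->
    (c `^ (s - 1) * (1 - t / c) `^ (c - 1)) * (1 - (1 - t / c)) `^ (- (1 - s)).
    exact: cvgMr.
  have -> : beta_integrand s c t =
      (c `^ (s - 1) * (1 - t / c) `^ (c - 1)) * (1 - (1 - t / c)) `^ (- (1 - s)).
    rewrite /beta_integrand E.
    have -> : 1 - (1 - t / c) = t / c by ring.
    have -> : - (1 - s) = s - 1 by ring.
    rewrite mulrAC -powRM ?(ltW c0) ?(ltW tc0)//; congr (_ `^ _ * _).
    by field; exact: lt0r_neq0.
  apply: cvg_trans B; apply: near_eq_cvg; apply: nearW => N /=.
  rewrite /series/= mulr_sumr; apply: eq_bigr => n _; rewrite /f E.
  have -> : (1 - t / c) `^ (c + n%:R - 1) = (1 - t / c) `^ (c - 1) * (1 - t / c) ^+ n.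
    rewrite -powR_mulrn ?(ltW P)// -powRD ?(gt_eqF P) ?implybT//.
    by congr (_ `^ _); ring.
  by ring.
rewrite integral_nneseries//; last 2 first.
- by move=> n; apply/measurable_EFinP; exact: mf.
- by move=> n t _; rewrite lee_fin.
apply: eq_eseriesr => n _.
rewrite integral_itv_obnd_cbnd; last by apply/measurable_EFinP; exact: mf.
have -> : (\int[@mu R]_(t in `[x, +oo[) (f n t)%:E =
   (c `^ (s - 1) * binom_coef (1 - s) n)%:E *
   \int[@mu R]_(t in `[x, +oo[) (posp (1 - t / c) `^ (c + n%:R - 1))%:E)%E.
  rewrite -ge0_integralZl_EFin//.
  - by move=> t _; rewrite lee_fin powR_ge0.
  - by apply/measurable_EFinP; exact: measurable_posp_powR.
rewrite integral_posp_powR//; last by have := ler0n R n; lra.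
by rewrite -EFinM; congr EFin; ring.
Qed.

(** * Convergence *)

Lemma Gamma1 (R : realType) : Gamma 1 = 1 :> R.
Proof.
rewrite /Gamma /Rintegral.
under eq_integral do rewrite subrr powRr0 mul1r -mulN1r.
by rewrite integral_expRM// mulr0 expR0 invr1 mulr1.
Qed.

Lemma hyp2F1C (R : realType) (p q r z : R) : hyp2F1 p q r z = hyp2F1 q p r z.
Proof.
by rewrite /hyp2F1; congr (limn (series _)); apply/funext => n; rewrite [_ * pochhammer q n]mulrC.
Qed.

Lemma gauss_hyp_covC (R : realType) (d : nat) (a alpha beta gamma : R) (h : 'rV[R]_d) :
  gauss_hyp_cov a alpha beta gamma h = gauss_hyp_cov a alpha gamma beta h.
Proof.
rewrite /gauss_hyp_cov /=.
have -> : gamma - alpha + beta - d%:R / 2 = beta - alpha + gamma - d%:R / 2 by ring.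
by rewrite (hyp2F1C (beta - alpha)) (mulrC (Gamma (beta - d%:R / 2))).
Qed.

(** The partial sums of the Gauss series are those of the termwise integrals times [c^(1-s) / u^c],
    so they converge because the integral is finite; u = 1 (that is, x = 0) needs no separate
    treatment. *)
Lemma hyp2F1_beta_integral (R : realType) (s c x : R) (u := posp (1 - x / c)) :
  0 < s < 1 -> 2 <= c -> 0 <= x ->
  u `^ c * hyp2F1 (1 - s) c (c + 1) u =
  c `^ (1 - s) * \int[@mu R]_(t in `]x, +oo[) beta_integrand s c t.
Proof.
move=> s01 c2 x0; have c0 : 0 < c by lra.
set I := Rintegral _ _ _.
have ib : (@mu R).-integrable `]x, +oo[ (EFin \o beta_integrand s c).
  apply: integrableS (integrable_beta_integrand s01 c2) => //.
  by move=> t /=; rewrite !in_itv/= !andbT; exact: le_lt_trans.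
pose v n := binom_coef (1 - s) n * (c / (c + n%:R)) * u ^+ n.
pose w n := c `^ (s - 1) * (binom_coef (1 - s) n * (c / (c + n%:R))) * u `^ (c + n%:R).
have cn n : 0 < c + n%:R by rewrite ltr_wpDr.
have cs : c `^ (1 - s) * c `^ (s - 1) = 1.
  by rewrite -powRD ?(gt_eqF c0) ?implybT// (_ : 1 - s + (s - 1) = 0) ?powRr0//; ring.
have w0 n : 0 <= w n.
  apply: mulr_ge0; last exact: powR_ge0.
  apply: mulr_ge0; first exact: powR_ge0.
  apply: mulr_ge0; first by apply: binom_coef_ge0; lra.
  by apply: divr_ge0; exact: ltW.
have wI : series w @ \oo --> I.
  apply: cvg_series_nneseries => //.
  rewrite /w -beta_integral_series//; last by lra.
  by rewrite /I /Rintegral fineK//; exact: integrable_fin_num.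
have -> : hyp2F1 (1 - s) c (c + 1) u = limn (series v).
  rewrite /hyp2F1; congr (limn (series _)); apply/funext => n; rewrite /v /binom_coef.
  have Q : pochhammer (c + 1) n != 0 by apply: lt0r_neq0; apply: pochhammer_gt0; lra.
  have F : n`!%:R != 0 :> R by rewrite pnatr_eq0 -lt0n fact_gt0.
  have -> : pochhammer c n = c * pochhammer (c + 1) n / (c + n%:R).
    by rewrite -pochhammer_shift mulfK// lt0r_neq0.
  by field; rewrite F Q lt0r_neq0.
have u0 : 0 <= u by rewrite le_max lexx orbT.
(* At u = 0 one cannot divide by [u^c], but both sides are 0. *)
move: u0; rewrite le_eqVlt => /predU1P[u0|u0].
  have -> : I = 0.
    apply: (cvg_unique _ wI) => //; rewrite (_ : series w = cst 0); first exact: cvg_cst.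
    apply/funext => N; rewrite /series/= big1// => n _.
    by rewrite /w -u0 powR0 ?mulr0// gt_eqF.
  by rewrite -u0 powR0 ?gt_eqF// mul0r mulr0.
have cu : 0 < u `^ c by exact: powR_gt0.
have E : series v = (fun N => (c `^ (1 - s) / u `^ c) * series w N).
  apply/funext => N; rewrite /series/= mulr_sumr; apply: eq_bigr => n _.
  have uD : u `^ (c + n%:R) = u `^ c * u ^+ n.
    by rewrite powRD ?(gt_eqF u0) ?implybT// powR_mulrn ?(ltW u0).
  rewrite /v /w uD.
  set A := binom_coef _ _ * _.
  have -> : c `^ (1 - s) / u `^ c * (c `^ (s - 1) * A * (u `^ c * u ^+ n)) =
    (c `^ (1 - s) * c `^ (s - 1)) * (u `^ c / u `^ c) * (A * u ^+ n) by ring.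
  by rewrite cs divff ?gt_eqF// !mul1r.
have vI : series v @ \oo --> (c `^ (1 - s) / u `^ c) * I.
  by rewrite E; exact: cvgMr.
rewrite (cvg_lim _ vI)//; field; exact: lt0r_neq0.
Qed.

Lemma gauss_hyp_cov_beta_integral (R : realType) (d : nat) (a alpha gamma : R) (h : 'rV[R]_d)
    (s := alpha - d%:R / 2) (c := gamma - alpha) :
  0 < s < 1 -> 2 <= c ->
  gauss_hyp_cov a alpha (d%:R / 2 + 1) gamma h =
  (Gamma s)^-1 * (Gamma (c + s) * c `^ (1 - s) / Gamma (c + 1) *
   \int[@mu R]_(t in `]c * (eucl_norm h ^+ 2 / a ^+ 2), +oo[) beta_integrand s c t).
Proof.
move=> s01 c2; have c0 : 0 < c by lra.
rewrite /gauss_hyp_cov /=.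
have -> : d%:R / 2 + 1 - d%:R / 2 = 1 :> R by ring.
have -> : d%:R / 2 + 1 - alpha + gamma - d%:R / 2 = c + 1 by rewrite /c; ring.
have -> : gamma - d%:R / 2 = c + s by rewrite /c /s; ring.
have -> : d%:R / 2 + 1 - alpha = 1 - s by rewrite /s; ring.
rewrite -/s -/c addrK Gamma1 mul1r.
set x := c * _.
have -> : eucl_norm h ^+ 2 / a ^+ 2 = x / c by rewrite /x [c * _]mulrC mulfK// lt0r_neq0.
have x0 : 0 <= x by rewrite /x mulr_ge0 ?(ltW c0)// divr_ge0 ?sqr_ge0.
rewrite -mulrA hyp2F1_beta_integral// invfM; ring.
Qed.

(** * Dependence of the incomplete gamma integral on its endpoint *)

Lemma upper_gamma_le (R : realType) (s x y : R) : 0 < s <= 1 -> 0 < x -> x <= y ->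
  0 <= \int[@mu R]_(t in `[x, +oo[) (t `^ (s - 1) * expR (- t)) -
       \int[@mu R]_(t in `[y, +oo[) (t `^ (s - 1) * expR (- t)) <= (y - x) / x.
Proof.
move=> /andP[s0 s1] x0 xy; have ig := integrable_gamma s0.
have ix : (@mu R).-integrable `[x, +oo[ (EFin \o (fun t => t `^ (s - 1) * expR (- t))).
  by apply: integrableS ig => // t /=; rewrite !in_itv/= !andbT; lra.
have iy : (@mu R).-integrable `]y, +oo[ (EFin \o (fun t => t `^ (s - 1) * expR (- t))).
  by apply: integrableS ig => // t /=; rewrite !in_itv/= !andbT; lra.
have ixy : (@mu R).-integrable `[x, y] (EFin \o (fun t => t `^ (s - 1) * expR (- t))).
  by apply: integrableS ig => // t /=; rewrite !in_itv/= => /andP[? _]; rewrite andbT; lra.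
rewrite -(Rintegral_itv_obnd_cbnd iy) -(Rintegral_itvB ix) ?bnd_simp// subKr.
have gt0 (t : R) : 0 <= t `^ (s - 1) * expR (- t) by rewrite mulr_ge0 ?powR_ge0 ?expR_ge0.
rewrite Rintegral_ge0//=.
have ic : (@mu R).-integrable `[x, y] (EFin \o (fun=> x^-1)).
  apply: continuous_compact_integrable; first exact: segment_compact.
  by apply: continuous_subspaceT => ?; exact: cst_continuous.
apply: (@le_trans _ _ (\int[@mu R]_(t in `[x, y]) x^-1)).
  apply: le_Rintegral => // t /=; rewrite in_itv/= => /andP[xt _].
  have t0 : 0 < t by lra.
  apply: (@le_trans _ _ t^-1); last by rewrite lef_pV2 ?posrE.
  rewrite -(@ler_pM2l _ t)// mulfV ?lt0r_neq0// mulrA -powR_split1//.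
  (* The bound 1/t on the integrand amounts to [t^s <= 1 + t <= e^t]. *)
  have ts : t `^ s <= expR t.
    by apply: le_trans (expR_ge1Dx t); apply: powR_le1D; lra.
  by have := ler_wpM2r (expR_ge0 (- t)) ts; rewrite expRxMexpNx_1.
rewrite Rintegral_cst//= lebesgue_measure_itv/= lte_fin.
by have [xy'|yx] := ltP x y; rewrite /= ?mulr0 ?[x^-1 * _]mulrC// divr_ge0; lra.
Qed.

(** Dividing the length of the interval by its smaller endpoint cancels y, leaving (1 - l)/l or l -
    1; this is what makes the bound uniform in y. The factor 2 comes from l >= 1/2. *)
Lemma upper_gamma_scale (R : realType) (s y l : R) : 0 < s <= 1 -> 0 <= y -> 2^-1 <= l ->
  `|\int[@mu R]_(t in `[l * y, +oo[) (t `^ (s - 1) * expR (- t)) -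
    \int[@mu R]_(t in `[y, +oo[) (t `^ (s - 1) * expR (- t))| <= 2 * `|l - 1|.
Proof.
move=> s01 y0 l2; move: y0; rewrite le_eqVlt => /predU1P[<-|y0].
  by rewrite mulr0 subrr normr0 mulr_ge0.
have l0 : 0 < l by lra.
have ly0 : 0 < l * y by rewrite mulr_gt0.
have [l1|l1] := leP l 1.
  have ly : l * y <= y by rewrite ler_piMl// ltW.
  have /andP[A B] := upper_gamma_le s01 ly0 ly.
  rewrite ger0_norm//; apply: (le_trans B).
  rewrite ler0_norm; last by lra.
  have -> : (y - l * y) / (l * y) = (1 - l) / l by field; lra.
  rewrite ler_pdivrMr// opprB.
  have P : 0 <= 1 - l by lra.
  have := ler_wpM2l P l2; lra.
have ly : y <= l * y by rewrite ler_peMl// ltW.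
have /andP[A B] := upper_gamma_le s01 y0 ly.
rewrite distrC ger0_norm//; apply: (le_trans B); rewrite gtr0_norm; last by lra.
have -> : (l * y - y) / y = l - 1 by field; lra.
lra.
Qed.

Lemma beta_integral_approx (R : realType) (s c x : R) : 0 < s < 1 -> 2 <= c -> 0 <= x ->
  `|\int[@mu R]_(t in `]x, +oo[) beta_integrand s c t -
    \int[@mu R]_(t in `[x, +oo[) (t `^ (s - 1) * expR (- t))| <= 256 / c.
Proof.
move=> s01 c2 x0; have s0 : 0 < s by lra.
have ci : 0 < c^-1 by rewrite invr_gt0; lra.
have ib : (@mu R).-integrable `]x, +oo[ (EFin \o beta_integrand s c).
  apply: integrableS (integrable_beta_integrand s01 c2) => //.
  by move=> t /=; rewrite !in_itv/= !andbT; exact: le_lt_trans.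
have ig : (@mu R).-integrable `]x, +oo[ (EFin \o (fun t => t `^ (s - 1) * expR (- t))).
  apply: integrableS (integrable_gamma s0) => //.
  by move=> t /=; rewrite !in_itv/= !andbT; lra.
have q0 : 0 < 4^-1 :> R by rewrite invr_gt0.
have ie0 : (@mu R).-integrable `]x, +oo[ (EFin \o (fun t => expR (- 4^-1 * t))).
  apply: integrableS (integrable_expRM x q0) => //.
  by move=> t /=; rewrite !in_itv/= !andbT; exact: ltW.
have ie : (@mu R).-integrable `]x, +oo[ (EFin \o (fun t => 64 / c * expR (- 4^-1 * t))).
  by apply: (integrableZl _ _ ie0).
have id : (@mu R).-integrable `]x, +oo[
    (EFin \o (fun t => beta_integrand s c t - t `^ (s - 1) * expR (- t))).
  by have := integrableB _ ib ig; apply.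
rewrite -(Rintegral_itv_obnd_cbnd ig) -RintegralB//.
apply: (le_trans (le_normr_Rintegral _ id)) => //.
apply: (@le_trans _ _ (\int[@mu R]_(t in `]x, +oo[) (64 / c * expR (- 4^-1 * t)))).
  apply: le_Rintegral => //.
    by have := integrable_abse id; apply: eq_integrable.
  move=> t /=; rewrite in_itv/= andbT => xt.
  by apply: beta_integrand_approx => //; lra.
(* The integral of [e^(-t/4)] beyond x is [4 e^(-x/4) <= 4], hence 256 = 64 * 4. *)
rewrite RintegralZl// (Rintegral_itv_obnd_cbnd ie0) /Rintegral integral_expRM//= invrK.
have e1 : expR (- 4^-1 * x) <= 1 by rewrite expR_le1 mulNr oppr_le0 mulr_ge0// ltW.
have := ler_wpM2l (ltW ci) e1; lra.
Qed.

Lemma gauss_hyp_cov_error (R : realType) (d : nat) (a b alpha gamma : R) (h : 'rV[R]_d)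
    (s := alpha - d%:R / 2) (c := gamma - alpha) (l := c * b ^+ 2 / a ^+ 2) :
  0 < s < 1 -> 0 < a -> 0 < b -> 2 <= c -> 2^-1 <= l ->
  `|gauss_hyp_cov a alpha (d%:R / 2 + 1) gamma h -
    Qgamma s (eucl_norm h ^+ 2 / b ^+ 2)| <=
  (Gamma s)^-1 * ((256 + Gamma s) / c + 2 * `|l - 1|).
Proof.
move=> s01 a0 b0 c2 l2; have c0 : 0 < c by lra.
have s0 : 0 < s by lra.
have G0 := Gamma_gt0 s0.
rewrite gauss_hyp_cov_beta_integral// -/s -/c /Qgamma -mulrBr normrM gtr0_norm ?invr_gt0//.
rewrite ler_wpM2l ?invr_ge0 ?(ltW G0)//.
set k := Gamma (c + s) * _ / _; set y := eucl_norm h ^+ 2 / b ^+ 2.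
have y0 : 0 <= y by rewrite divr_ge0 ?sqr_ge0.
(* All dependence on h is now in y; the two lower endpoints are l y and y. *)
have -> : c * (eucl_norm h ^+ 2 / a ^+ 2) = l * y by rewrite /l /y; field; lra.
have ly0 : 0 <= l * y by rewrite mulr_ge0//; lra.
have A := beta_integral_approx s01 c2 ly0.
have B := @upper_gamma_scale R s y l ltac:(lra) y0 l2.
have /andP[k1 k2] := @Gamma_ratio_bounds R c s ltac:(lra) ltac:(lra).
rewrite -/k in k1 k2.
set I := Rintegral _ _ _ in A *; set U := Rintegral _ _ _ in A B; set V := Rintegral _ _ _ in B *.
have U0 : 0 <= U.
  by apply: Rintegral_ge0 => t _; rewrite mulr_ge0 ?powR_ge0 ?expR_ge0.
have UG : U <= Gamma s.
  rewrite /U /Gamma /Rintegral fine_le//.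
  - apply: integrable_fin_num => //; apply: integrableS (integrable_gamma s0) => //.
    by move=> t /=; rewrite !in_itv/= !andbT; exact: le_trans.
  - exact: integrable_fin_num (integrable_gamma s0).
  - apply: ge0_subset_integral => //=.
    + by apply/measurable_EFinP; exact: measurable_powR_expR.
    + by move=> t _; rewrite lee_fin mulr_ge0 ?powR_ge0 ?expR_ge0.
    + by move=> t /=; rewrite !in_itv/= !andbT; exact: le_trans.
have sc : s / (c + s) <= c^-1.
  by rewrite ler_pdivrMr; [rewrite -(@ler_pM2l _ c)// mulrA mulfV ?mul1r ?lt0r_neq0//; nra | lra].
have k0 : 0 <= k.
  have : s / (c + s) <= 1 by rewrite ler_pdivrMr; lra.
  lra.
(* The three errors: beta integrand against gamma integrand (with k <= 1), k against 1 (with U <=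
   [Gamma s]), and endpoint l y against y. *)
have -> : k * I - V = k * (I - U) + (k - 1) * U + (U - V) by ring.
have N1 : `|k * (I - U)| <= 256 / c.
  rewrite normrM ger0_norm//; apply: le_trans A.
  by rewrite ler_piMl.
have N2 : `|(k - 1) * U| <= Gamma s / c.
  rewrite normrM (ger0_norm U0) ler0_norm; last by lra.
  have K1 : - (k - 1) <= c^-1 by lra.
  have K0 : 0 <= - (k - 1) by lra.
  by have := ler_pM K0 U0 K1 UG; lra.
apply: (le_trans (ler_normD _ _)); apply: (le_trans (lerD (ler_normD _ _) (lexx _))).
lra.
Qed.

Lemma cvg_uniform_near (R : realType) (T : choiceType) (I : Type) (F : set_system I)
    (FF : Filter F) (f : I -> T -> R) (g : T -> R) :
  (forall e, 0 < e -> \forall i \near F, forall t, `|f i t - g t| < e) ->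
  {uniform, f @ F --> g}.
Proof.
move=> H Q /uniform_nbhs [E [entE EQ]].
move: entE; rewrite -entourage_ballE => -[e /= e0 eE].
have := H e e0; apply: filterS => i fg; apply: EQ => t _.
by apply: eE; rewrite /= /ball /= distrC.
Qed.

(** The quantity equals [(1 - alpha/gamma) * b^2 / (a / sqrt gamma)^2] once a and gamma are
    positive. *)
Lemma scale_cvg1 (R : realType) (I : Type) (F : set_system I) (FF : ProperFilter F)
    (a gamma : I -> R) (alpha b : R) : 0 < b ->
  a i @[i --> F] --> +oo -> gamma i @[i --> F] --> +oo ->
  a i / Num.sqrt (gamma i) @[i --> F] --> b ->
  (gamma i - alpha) * b ^+ 2 / a i ^+ 2 @[i --> F] --> (1 : R).
Proof.
move=> b0 ay gy ab.
have a0 : \forall i \near F, 0 < a i.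
  by move/cvgryPgt : ay => /(_ 0).
have g0 : \forall i \near F, 0 < gamma i.
  by move/cvgryPgt : gy => /(_ 0).
have gi : (gamma i)^-1 @[i --> F] --> (0 : R) by apply/gtr0_cvgV0.
have b2 : b ^+ 2 != 0 by rewrite expf_neq0// lt0r_neq0.
have lim : (1 - alpha * (gamma i)^-1) * (b ^+ 2 * ((a i / Num.sqrt (gamma i)) ^+ 2)^-1)
    @[i --> F] --> (1 - alpha * 0) * (b ^+ 2 * (b ^+ 2)^-1).
  apply: cvgM.
    by apply: cvgB; [exact: cvg_cst|apply: cvgM; [exact: cvg_cst|exact: gi]].
  apply: cvgM; first exact: cvg_cst.
  by apply: cvgV => //; rewrite !expr2; apply: cvgM.
move: lim; rewrite mulr0 subr0 mul1r mulfV//.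
apply: cvg_trans; apply: near_eq_cvg; near=> i.
have gi0 : 0 < gamma i by near: i.
have ai0 : 0 < a i by near: i.
rewrite expr_div_n sqr_sqrtr ?(ltW gi0)// invf_div.
by field; lra.
Unshelve. all: by end_near. Qed.

Lemma gauss_hyp_cov_cvg (R : realType) (d : nat) (alpha b : R)
    (I : Type) (F : set_system I) (FF : ProperFilter F) (a gamma : I -> R) :
  0 < alpha - d%:R / 2 < 1 -> 0 < b ->
  a i @[i --> F] --> +oo -> gamma i @[i --> F] --> +oo ->
  a i / Num.sqrt (gamma i) @[i --> F] --> b ->
  {uniform, (fun i : I => @gauss_hyp_cov R d (a i) alpha (d%:R / 2 + 1) (gamma i)) @ F -->
     (fun h : 'rV[R]_d => Qgamma (alpha - d%:R / 2) (eucl_norm h ^+ 2 / b ^+ 2))}.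
Proof.
move=> s01 b0 ay gy ab; apply: cvg_uniform_near => e e0.
set s := alpha - d%:R / 2 in s01 *.
have s0 : 0 < s by lra.
have G0 := Gamma_gt0 s0.
have l1 := scale_cvg1 FF alpha b0 ay gy ab.
(* Once c exceeds [M], the first error term is below [Gamma s * (e / 4)]; the endpoint term is below
   twice that, so the total stays under three quarters of the allowance. *)
pose M := (256 + Gamma s) / (Gamma s * (e / 4)).
have Ge : 0 < Gamma s * (e / 4) by rewrite mulr_gt0// divr_gt0.
near=> i => h.
have a0 : 0 < a i by near: i; move/cvgryPgt : ay => /(_ 0).
have c2 : 2 <= gamma i - alpha.
  by rewrite lerBrDr; near: i; move/cvgryPge : gy; apply.
have cM : M < gamma i - alpha.
  by rewrite ltrBrDr; near: i; move/cvgryPgt : gy; apply.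
have l2 : `|1 - (gamma i - alpha) * b ^+ 2 / a i ^+ 2| < 2^-1.
  by near: i; move/cvgrPdist_lt : l1; apply; rewrite invr_gt0.
have l3 : `|1 - (gamma i - alpha) * b ^+ 2 / a i ^+ 2| < Gamma s * (e / 4).
  by near: i; move/cvgrPdist_lt : l1; apply.
have l2' : 2^-1 <= (gamma i - alpha) * b ^+ 2 / a i ^+ 2.
  by move: l2; rewrite ltr_norml => /andP[_]; lra.
apply: (le_lt_trans (gauss_hyp_cov_error h s01 a0 b0 c2 l2')).
rewrite -/s distrC ltr_pdivrMl//.
have c0 : 0 < gamma i - alpha by lra.
have : (256 + Gamma s) / (gamma i - alpha) < Gamma s * (e / 4).
  by move: cM; rewrite /M !ltr_pdivrMr// [(gamma i - alpha) * _]mulrC.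
move: l3; set u := `|_|; set v := _ / _; set w := Gamma s * (e / 4) => l3 l4.
have -> : Gamma s * e = 4 * w by rewrite /w; field.
have w0 : 0 < w by [].
lra.
Unshelve. all: by end_near. Qed.

(** The joint limit in a and gamma is taken along an arbitrary proper filter on an arbitrary index
    type, which covers sequences as well as any coupled regime of the two parameters. *)
Theorem theorem14 (R : realType) (d : nat) (hd : (1 <= d)%N)
    (beta : R) (hbeta : beta = d%:R / 2 + 1)
    (alpha : R) (halpha : d%:R / 2 < alpha) (halphabeta : alpha < beta)
    (b : R) (hb : 0 < b) :
  let limit_cov := fun h : 'rV[R]_d =>
    Qgamma (alpha - d%:R / 2) (eucl_norm h ^+ 2 / b ^+ 2) in
  covariance_kernel limit_cov /\
  (forall (I : Type) (F : set_system I) (FF : ProperFilter F)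
      (a gamma : I -> R),
    a i @[i --> F] --> +oo ->
    gamma i @[i --> F] --> +oo ->
    a i / Num.sqrt (gamma i) @[i --> F] --> b ->
    {uniform, (fun i : I => gauss_hyp_cov (a i) alpha beta (gamma i)) @ F
                --> limit_cov} /\
    {uniform, (fun i : I => gauss_hyp_cov (a i) alpha (gamma i) beta) @ F
                --> limit_cov}).
Proof.
have s01 : 0 < alpha - d%:R / 2 < 1 by move: halphabeta; rewrite hbeta; lra.
move=> limit_cov; split; first exact: Qgamma_covariance.
move=> I F FF a gamma ay gy ab.
have H : {uniform, (fun i : I => gauss_hyp_cov (a i) alpha beta (gamma i)) @ F --> limit_cov}.
  by rewrite hbeta; exact: gauss_hyp_cov_cvg.
split; first exact: H.
(* The covariance is symmetric in its last two parameters, as the Gauss series is in its two upper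
   ones. *)
have -> : (fun i : I => @gauss_hyp_cov R d (a i) alpha (gamma i) beta) =
    (fun i => gauss_hyp_cov (a i) alpha beta (gamma i)).
  by apply/funext => i; apply/funext => h; rewrite gauss_hyp_covC.
exact: H.
Qed.
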